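(* Let $(M,g,S(TM))$ be a totally geodesic lightlike hypersurface of a Lorentzian manifold $(\overline M,\overline g)$, with $\mathrm{Rad}\,TM$ spanned by a globally defined null vector field $\xi$, and let $S$ be an $\mathcal A^{\nabla}$-tensor on $(M,g,S(TM))$ with exactly three eigenfunctions $\lambda_0=$ constant, $\alpha$, $\beta$, and with constant trace. Let $D_0=\mathrm{Ker}(\lambda_0I-S)=\mathrm{Rad}\,TM$, $D_\alpha=\mathrm{Ker}(\alpha I-S)$, $D_\beta=\mathrm{Ker}(\beta I-S)$, with $S(TM)=D_\alpha\oplus D_\beta$. Then $\nabla^g\alpha$ and $\nabla^g\beta$ are $D_0=\mathrm{Rad}\,TM$-valued. If, in addition, $S(TM)$ is totally geodesic, then the distributions $D_\alpha$ and $D_\beta$ are both integrable if and only if $\nabla S$ vanishes on $S(TM)\times S(TM)$.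
   Context: Setting. $(\overline M,\overline g)$ is a Lorentzian manifold of dimension $n+2$ with Levi-Civita connection $\overline\nabla$. A hypersurface $M$ with induced tensor $g$ is lightlike if $g$ has constant rank $n$; then $TM^{\perp}\subset TM$ is a rank-one distribution equal to $\mathrm{Rad}\,TM=TM\cap TM^\perp$. A screen distribution $S(TM)$ is a rank $n$ complement, $TM=S(TM)\perp TM^{\perp}$ (here $S(TM)$ is Riemannian); $(M,g,S(TM))$ denotes $M$ with a chosen screen distribution. $P$ denotes the projection of $TM$ onto $S(TM)$. There is a unique null section $N$ of $T\overline M|_M$ with $\overline g(N,\xi)=1$, $\overline g(N,N)=\overline g(N,W)=0$ for all $W\in\Gamma(S(TM))$, and $T\overline M|_M=TM\oplus \mathrm{span}\{N\}$. Put $\eta=\overline g(N,\cdot)$. The induced connection $\nabla$ on $M$ is $\nabla_XY=$ the $TM$-component of $\overline\nabla_XY$ in this decomposition. $M$ is totally geodesic if $\overline\nabla_XY\in TM$ for all $X,Y\in\Gamma(TM)$; then $\nabla$ is torsion-free and $\nabla g=0$. The second fundamental form of the screen distribution is $C(X,PY)=\eta(\nabla_XPY)$, and $S(TM)$ is totally geodesic (in $M$) if $C=0$. Duality: $X^\flat=g(X,\cdot)+\eta(X)\eta(\cdot)$, $\tilde g(X,Y)=X^\flat(Y)$ (a nondegenerate metric on $M$), and the gradient $\nabla^gf$ of a function $f$ is defined by $\tilde g(\nabla^gf,X)=df(X)$. $\mathcal A^{\nabla}$-tensors: for $S\in \mathrm{End}(TM)$ put $\nabla S(X,Y)=(\nabla_XS)Y=\nabla_X(SY)-S(\nabla_XY)$.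 An $\mathcal A^\nabla$-tensor on $(M,g,S(TM))$ is a smooth $S\in\mathrm{End}(TM)$ which is screen preserving ($PS=SP$) and satisfies $g(SX,Y)=g(X,SY)$ for all $X,Y$ and $X^\flat(\nabla S(X,X))=0$ for all $X\in TM$. Standing assumption on eigenvalues: $M$ is connected and the number of distinct eigenvalues of $S_x$ is constant in $x\in M$, so that the distinct eigenvalues are smooth functions whose eigendistributions have constant rank; the eigenspace of $\lambda_0$ is $\mathrm{Rad}\,TM$ and the others lie in $S(TM)$. *)

(* Defs.v *)
From HB Require Import structures.
From mathcomp Require Import all_boot all_order all_algebra.
From mathcomp Require Import all_classical all_reals all_analysis.

Set Implicit Arguments.
Unset Strict Implicit.
Unset Printing Implicit Defensive.

Import Order.TTheory GRing.Theory Num.Theory.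
Import numFieldNormedType.Exports.

Local Open Scope classical_set_scope.
Local Open Scope ring_scope.

(* Meant for open sets U only.                                                *)
Fixpoint Ck (R : realType) (V W : normedModType R) (k : nat) (U : set V)
    (f : V -> W) : Prop :=
  match k with
  | 0 => forall x, U x -> {for x, continuous f}
  | k'.+1 => (forall x, U x -> differentiable f x) /\
             (forall v : V, Ck k' U (fun x => 'D_v f x))
  end.

Definition smooth_on (R : realType) (V W : normedModType R) (U : set V)
    (f : V -> W) : Prop := forall k, Ck k U f.

(* The atlas is indexed by the points of the manifold: the
   chart [chart x] is defined on the open set [chart_dom x], which contains x.
   Outside [chart_dom x] (resp. outside its image) the values of [chart x]
   (resp. [chart_inv x]) are irrelevant.                                      *)

Record manifold (R : realType) (m : nat) := Manifold {
  carrier :> topologicalType;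
  manifold_hausdorff : hausdorff_space carrier;
  manifold_countable : @second_countable carrier;
  chart_dom : carrier -> set carrier;
  chart : carrier -> carrier -> 'rV[R]_m;
  chart_inv : carrier -> 'rV[R]_m -> carrier;
  chart_dom_open : forall x, open (chart_dom x);
  chart_dom_center : forall x, chart_dom x x;
  chart_image_open : forall x, open (chart x @` chart_dom x);
  chartK : forall x y, chart_dom x y -> chart_inv x (chart x y) = y;
  chart_continuous : forall x y, chart_dom x y -> {for y, continuous (chart x)};
  chart_inv_continuous : forall x y, chart_dom x y ->
    {for chart x y, continuous (chart_inv x)};
  chart_transition : forall x y,
    smooth_on (chart x @` (chart_dom x `&` chart_dom y))
              (chart y \o chart_inv x)
}.

Section Calculus.
Context {R : realType} {m k : nat} {M : manifold R m} {N : manifold R k}.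

Definition smooth_fun (U : set M) (f : M -> R) : Prop :=
  forall x : M, smooth_on (chart x @` (U `&` chart_dom x))
                          (f \o chart_inv x : _ -> R^o).

Definition smooth_map (F : M -> N) : Prop :=
  continuous F /\
  forall x y, smooth_on (chart x @` (chart_dom x `&` F @^-1` chart_dom y))
                        (chart y \o F \o chart_inv x).

(* The tangent space at x is 'rV[R]_m: a row vector lists the components of a
   tangent vector at x in the coordinate basis of the chart [chart x].  Linear
   maps between tangent spaces are matrices acting on the right.              *)

(* The differential at x of F, from the tangent space of M at x to the tangent
   space of N at F x.                                                         *)
Definition dmap (F : M -> N) (x : M) : 'M[R]_(m, k) :=
  'J (chart (F x) \o F \o chart_inv x) (chart x x).

(* df(v), for v tangent at x. *)
Definition dfun (f : M -> R) (x : M) (v : 'rV[R]_m) : R :=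
  'D_v (f \o chart_inv x : _ -> R^o) (chart x x).

(* Right multiplication by [tcoord x y] turns the components, in the chart
   [chart y], of a tangent vector at y into its components in [chart x].      *)
Definition tcoord (x y : N) : 'M[R]_k :=
  'J (chart x \o chart_inv y) (chart y y).

(* The local expression, in the chart c of N and the chart of M at x, of a
   vector field Y along F (Y y is tangent to N at F y).                       *)
Definition local_rep (F : M -> N) (c : N) (x : M) (Y : M -> 'rV[R]_k) :
    'rV[R]_m -> 'rV[R]_k :=
  fun u => Y (chart_inv x u) *m tcoord c (F (chart_inv x u)).

Definition smooth_along (F : M -> N) (U : set M) (Y : M -> 'rV[R]_k) : Prop :=
  forall x c, smooth_on (chart x @` (U `&` chart_dom x `&` F @^-1` chart_dom c))
                        (local_rep F c x Y).

End Calculus.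

Section VectorFields.
Context {R : realType} {m : nat} {M : manifold R m}.

(* Local vector fields are total functions of which only the restriction to an
   open set U is meaningful.                                                  *)
Definition smooth_field (U : set M) (X : M -> 'rV[R]_m) : Prop :=
  smooth_along (id : M -> M) U X.

Definition bracket (X Y : M -> 'rV[R]_m) (x : M) : 'rV[R]_m :=
  'D_(X x) (local_rep (id : M -> M) x x Y) (chart x x)
  - 'D_(Y x) (local_rep (id : M -> M) x x X) (chart x x).

(* A subspace of the tangent space is given by the row space of a matrix. *)
Definition in_dist (D : M -> 'M[R]_m) (U : set M) (X : M -> 'rV[R]_m) : Prop :=
  smooth_field U X /\ forall x, U x -> (X x <= D x)%MS.

Definition distribution (r : nat) (D : M -> 'M[R]_m) : Prop :=
  (forall x, \rank (D x) = r) /\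
  forall x, exists (U : set M) (X : 'I_r -> M -> 'rV[R]_m),
    [/\ open U, U x, forall i, smooth_field U (X i)
      & forall y, U y -> (\matrix_(i < r) X i y == D y)%MS].

(* Integrability is closure under the bracket of local sections. *)
Definition integrable_dist (D : M -> 'M[R]_m) : Prop :=
  forall (U : set M) (X Y : M -> 'rV[R]_m), open U ->
    in_dist D U X -> in_dist D U Y ->
    forall x, U x -> (bracket X Y x <= D x)%MS.

Definition smooth_endo (S : M -> 'M[R]_m) : Prop :=
  forall (U : set M) (X : M -> 'rV[R]_m), open U -> smooth_field U X ->
    smooth_field U (fun x => X x *m S x).

(* Value on (u, v) of the bilinear form with matrix G. *)
Definition form (p : nat) (G : 'M[R]_p) (u v : 'rV[R]_p) : R :=
  (u *m G *m v^T) 0 0.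

Definition lorentzian (g : M -> 'M[R]_m) : Prop :=
  [/\ forall x, (g x)^T = g x,
      forall x, exists2 A : 'M[R]_m, A \in unitmx &
        A *m g x *m A^T
          = diag_mx (\row_(i < m) if (i : nat) == 0%N then -1 else 1)
    & forall (U : set M) (X Y : M -> 'rV[R]_m), open U ->
        smooth_field U X -> smooth_field U Y ->
        smooth_fun U (fun x => form (g x) (X x) (Y x))].

End VectorFields.

Section Connections.
Context {R : realType} {m k : nat} {M : manifold R m} {N : manifold R k}.

(* A connection on N is represented by its Christoffel symbols: [Gam p u v] is
   the value, at p and in the chart [chart p], of the bilinear map
   Gamma^i_{jl} u^j v^l.  The covariant derivative at x in the direction v of a
   field Y along F : M -> N is then
     v(Y^i) + Gamma^i_{jl} (dF v)^j Y^l.                                       *)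
Definition cov_along (Gam : N -> 'rV[R]_k -> 'rV[R]_k -> 'rV[R]_k)
    (F : M -> N) (x : M) (v : 'rV[R]_m) (Y : M -> 'rV[R]_k) : 'rV[R]_k :=
  'D_v (local_rep F (F x) x Y) (chart x x) + Gam (F x) (v *m dmap F x) (Y x).

End Connections.

Section LeviCivita.
Context {R : realType} {m : nat} {M : manifold R m}.
Implicit Types (Gam : M -> 'rV[R]_m -> 'rV[R]_m -> 'rV[R]_m).

Definition cov Gam (x : M) (v : 'rV[R]_m) (Y : M -> 'rV[R]_m) : 'rV[R]_m :=
  cov_along Gam (id : M -> M) x v Y.

Definition connection Gam : Prop :=
  [/\ forall x a u v w, Gam x (a *: u + v) w = a *: Gam x u w + Gam x v w,
      forall x a u v w, Gam x w (a *: u + v) = a *: Gam x w u + Gam x w v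
    & forall (U : set M) (X Y : M -> 'rV[R]_m), open U ->
        smooth_field U X -> smooth_field U Y ->
        smooth_field U (fun x => cov Gam x (X x) Y)].

Definition levi_civita (g : M -> 'M[R]_m) Gam : Prop :=
  [/\ connection Gam,
      forall (U : set M) (X Y : M -> 'rV[R]_m), open U ->
        smooth_field U X -> smooth_field U Y ->
        forall x, U x ->
          cov Gam x (X x) Y - cov Gam x (Y x) X = bracket X Y x
    & forall (U : set M) (X Y : M -> 'rV[R]_m), open U ->
        smooth_field U X -> smooth_field U Y ->
        forall x v, U x ->
          dfun (fun y => form (g y) (X y) (Y y)) x v
          = form (g x) (cov Gam x v X) (Y x) + form (g x) (X x) (cov Gam x v Y)].

End LeviCivita.

Definition induced (R : realType) (m k : nat) (M : manifold R m)
    (N : manifold R k) (g : N -> 'M[R]_k) (F : M -> N) (x : M) : 'M[R]_m :=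
  dmap F x *m g (F x) *m (dmap F x)^T.

(* A hypersurface is an injective immersion of codimension 1, not necessarily
   an embedding.  The radical of the induced tensor at x is the row space of
   [kermx (induced gbar incl x)].                                             *)
Record lightlike_hypersurface (R : realType) (n : nat) := LightlikeHypersurface {
  amb : manifold R n.+2;
  gbar : amb -> 'M[R]_n.+2;
  gbar_lorentzian : lorentzian gbar;
  nabar : amb -> 'rV[R]_n.+2 -> 'rV[R]_n.+2 -> 'rV[R]_n.+2;
  nabar_levi_civita : levi_civita gbar nabar;
  hyp :> manifold R n.+1;
  incl : hyp -> amb;
  incl_smooth : smooth_map incl;
  incl_inj : injective incl;
  incl_immersion : forall x, row_free (dmap incl x);
  induced_rank : forall x, \rank (induced gbar incl x) = n;
  screen : hyp -> 'M[R]_n.+1;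
  screen_dist : distribution n screen;
  screen_compl : forall x,
    (screen x + kermx (induced gbar incl x) == 1%:M)%MS /\
    (screen x :&: kermx (induced gbar incl x) = 0)%MS
}.

Section Lightlike.
Context {R : realType} {n : nat} (H : lightlike_hypersurface R n).

Definition gmx (x : H) : 'M[R]_n.+1 := induced (@gbar R n H) (@incl R n H) x.

Definition Rad (x : H) : 'M[R]_n.+1 := kermx (gmx x).

(* The projection onto the screen distribution along the radical. *)
Definition Pscr (x : H) : 'M[R]_n.+1 := proj_mx (screen x) (Rad x).

Definition push (Y : H -> 'rV[R]_n.+1) (x : H) : 'rV[R]_n.+2 :=
  Y x *m dmap (@incl R n H) x.

Definition spans_Rad (xi : H -> 'rV[R]_n.+1) : Prop :=
  smooth_field [set: H] xi /\ forall x, xi x != 0 /\ (xi x == Rad x)%MS.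

Definition null_transversal (xi : H -> 'rV[R]_n.+1) (N : H -> 'rV[R]_n.+2) :
    Prop :=
  smooth_along (@incl R n H) [set: H] N /\
  forall x, [/\ form (gbar (incl x)) (N x) (push xi x) = 1,
                form (gbar (incl x)) (N x) (N x) = 0
              & forall w : 'rV[R]_n.+1, (w <= screen x)%MS ->
                  form (gbar (incl x)) (N x) (w *m dmap (@incl R n H) x) = 0].

Definition nabla_amb (x : H) (v : 'rV[R]_n.+1) (Y : H -> 'rV[R]_n.+1) :
    'rV[R]_n.+2 :=
  cov_along (@nabar R n H) (@incl R n H) x v (push Y).

Definition totally_geodesic : Prop :=
  forall (U : set H) (X Y : H -> 'rV[R]_n.+1), open U ->
    smooth_field U X -> smooth_field U Y ->
    forall x, U x -> (nabla_amb x (X x) Y <= dmap (@incl R n H) x)%MS.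

Section Transversal.
Variable N : H -> 'rV[R]_n.+2.

Definition etamx (x : H) : 'cV[R]_n.+1 :=
  dmap (@incl R n H) x *m gbar (incl x) *m (N x)^T.

Definition eta (x : H) (v : 'rV[R]_n.+1) : R := (v *m etamx x) 0 0.

(* The component of w in TM with respect to the decomposition of the ambient
   tangent space at x as the direct sum of TM and span {N}: one has
   w = u *m dmap incl x + c *: N x for unique u = [tan_part x w] and c.       *)
Definition tan_part (x : H) (w : 'rV[R]_n.+2) : 'rV[R]_n.+1 :=
  lsubmx (w *m pinvmx (col_mx (dmap (@incl R n H) x) (N x))).

Definition nabla (x : H) (v : 'rV[R]_n.+1) (Y : H -> 'rV[R]_n.+1) :
    'rV[R]_n.+1 :=
  tan_part x (nabla_amb x v Y).

(* C(X, PY) = 0. *)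
Definition screen_totally_geodesic : Prop :=
  forall (U : set H) (X Y : H -> 'rV[R]_n.+1), open U ->
    smooth_field U X -> smooth_field U Y ->
    forall x, U x -> eta x (nabla x (X x) (fun y => Y y *m Pscr y)) = 0.

Definition flat (x : H) (u v : 'rV[R]_n.+1) : R :=
  form (gmx x) u v + eta x u * eta x v.

(* The matrix of the nondegenerate metric g~(u, v) = flat u v. *)
Definition gtilde (x : H) : 'M[R]_n.+1 := gmx x + etamx x *m (etamx x)^T.

(* The solution w of g~(w, v) = df(v) for all v. *)
Definition grad (f : H -> R) (x : H) : 'rV[R]_n.+1 :=
  (\row_j dfun f x (delta_mx 0 j)) *m invmx (gtilde x).

Definition nablaS (S : H -> 'M[R]_n.+1) (X Y : H -> 'rV[R]_n.+1) (x : H) :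
    'rV[R]_n.+1 :=
  nabla x (X x) (fun y => Y y *m S y) - nabla x (X x) Y *m S x.

Definition A_tensor (S : H -> 'M[R]_n.+1) : Prop :=
  [/\ smooth_endo S,
      forall x, Pscr x *m S x = S x *m Pscr x,
      forall x (u v : 'rV[R]_n.+1),
        form (gmx x) (u *m S x) v = form (gmx x) u (v *m S x)
    & forall (U : set H) (X : H -> 'rV[R]_n.+1), open U -> smooth_field U X ->
        forall x, U x -> flat x (X x) (nablaS S X X x) = 0].

End Transversal.
End Lightlike.

(* Main.v *)
(** Since the hypersurface is totally geodesic, the induced connection is
    torsion-free (by the symmetry of second derivatives of the immersion) and
    compatible with the degenerate metric g.  For a section X of D_alpha, the
    condition on nabla S(X, X) reads X(alpha) g(X, X) = 0, so alpha is constant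
    along D_alpha because g is anisotropic on the screen; the constant trace
    transports this to D_beta, and d(alpha) vanishes on the screen.  For the
    equivalence, put T(X, Y, Z) = g(nabla S(X, Y), Z).  It is symmetric in Y, Z,
    its cyclic sum vanishes, it vanishes when Y, Z lie in the same
    eigendistribution, and otherwise, with Y in D_alpha and Z in D_beta, it is
    (alpha - beta) g(nabla_X Y, Z).  For X, Y in D_alpha the cyclic identity makes
    g(nabla_X Y, Z) skew in X, Y, while integrability makes it symmetric. *)

Require Import Defs.
From HB Require Import structures.
From mathcomp Require Import all_boot all_order all_algebra.
From mathcomp Require Import ring lra.
From mathcomp Require Import all_classical all_reals all_analysis.

Set Implicit Arguments.
Unset Strict Implicit.
Unset Printing Implicit Defensive.

Import Order.TTheory GRing.Theory Num.Theory.
Import numFieldNormedType.Exports.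

Local Open Scope classical_set_scope.
Local Open Scope ring_scope.

(** * Functions of class C^k *)

(** The identities for $\nabla S$ and $\nabla$ concern fields, so a vector of an eigendistribution
    has to be extended to a smooth section of it. Applying $(S-\lambda_0)(S-\beta)$ to a coordinate
    field does this: it is a polynomial in $S$ with smooth coefficients whose values lie in
    $D_\alpha$. A similar device replaces the splitting of a screen field $Y$: $(S-\beta)Y$ and
    $(S-\alpha)Y$ are sections of $D_\alpha$ and $D_\beta$, and since $\alpha\ne\beta$, vanishing on
    both forces vanishing on $Y$.

    The degenerate $g$ does not see the radical, so $T=0$ alone says nothing about the
    $\xi$-component of $\nabla S$. This is where the geodesic screen enters: it makes $\nabla S$
    screen-valued on screen fields. The mixed case, $X$ in $D_\alpha$ and $Y$ in $D_\beta$, reduces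
    to the case of equal distributions by differentiating $g(D_\alpha,D_\beta)=0$.

    The ambient connection is characterised on fields of the ambient manifold, while pushed-forward
    fields are defined only along the immersion. Torsion and metricity along a map are therefore
    derived in coordinates, where they become the symmetry of a Hessian and a statement on metric
    coefficients. *)

Section Differentiability.
Context {R : realType} {V W : normedModType R}.

Lemma near0_differentiable (f : V -> W) (x : V) :
  (\near x, f x = 0) -> differentiable f x.
Proof.
move=> f0.
have H : f \o shift x = cst (f x) + (\0 : V -> W) +o_ 0 id.
  apply/eqaddoP => eps e0; rewrite (nbhs_singleton f0).
  have : \forall t \near (0 : V), (f \o shift x) t = 0.
    by move: f0; rewrite (near_shift 0) subr0.
  apply: filterS => t /= fh.
  have -> : (f \o shift x - (cst 0 + (\0 : V -> W))) t = 0.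
    by rewrite -[LHS]/(f (t + x) - (0 + 0)) fh addr0 subr0.
  by rewrite normr0 mulr_ge0 // ltW.
apply/diff_locallyP.
have -> : 'd f x = \0 :> (V -> W) by apply: diff_unique => //; exact: cst_continuous.
by split => //; exact: cst_continuous.
Qed.

(** Local expressions on a manifold agree only near a point, charts being arbitrary outside their
    domains. The difference [g - f] vanishes near [x], hence has differential zero there. *)
Lemma near_eq_differentiable (f g : V -> W) (x : V) :
  (\near x, f x = g x) -> differentiable f x -> differentiable g x.
Proof.
move=> fg df; have -> : g = f + (g - f).
  by apply/funext => y /=; rewrite -[RHS]/(f y + (g y - f y)) addrC subrK.
apply: differentiableD => //; apply: near0_differentiable.
apply: filterS fg => y /= fg.
by rewrite -[LHS]/(g y - f y) fg subrr.
Qed.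

Let scale_bilinear : bilinear_for
    (GRing.Scale.Law.clone _ _ *:%R _) (GRing.Scale.Law.clone _ _ *:%R _)
    (fun (k : R^o) (w : W) => k *: w).
Proof.
split=> [u'|u] a x y /=.
- by rewrite scalerDl scalerA.
- by rewrite scalerDr !scalerA mulrC.
Qed.

Let scale_fun := (fun (k : R^o) (w : W) => k *: w).
HB.instance Definition _ := bilinear_isBilinear.Build R R^o W W _ _
  scale_fun scale_bilinear.

(** The product is the pair [(k, f)] followed by a continuous bilinear map; the same factorisation
    yields the Leibniz rule [derive_scale]. *)
Lemma differentiable_scale (k : V -> R^o) (f : V -> W) (x : V) :
  differentiable k x -> differentiable f x ->
  differentiable (fun z => k z *: f z) x.
Proof.
move=> dk df.
apply: (@differentiable_comp _ _ _ _ (fun z => (k z, f z)) (fun p => scale_fun p.1 p.2)).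
  exact: differentiable_pair.
by apply: differentiable_bilin => p; exact: scale_continuous.
Qed.

Lemma derive_scale (k : V -> R^o) (f : V -> W) (x v : V) :
  differentiable k x -> differentiable f x ->
  'D_v (fun z => k z *: f z) x = 'D_v k x *: f x + k x *: 'D_v f x.
Proof.
move=> dk df; rewrite !deriveE//; last exact: differentiable_scale.
have sc : continuous (fun p : R^o * W => scale_fun p.1 p.2).
  by move=> p; exact: scale_continuous.
rewrite (@diff_comp _ _ _ _ (fun z => (k z, f z)) (fun p => scale_fun p.1 p.2)) /=.
- by rewrite diff_bilin//= diff_pair//= addrC.
- exact: differentiable_pair.
- exact: differentiable_bilin.
Qed.

End Differentiability.

Section Coordinates.
Context {R : realType} {V : normedModType R} {p : nat}.

Lemma differentiable_row_coord (f : V -> 'rV[R]_p) (x : V) (j : 'I_p) :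
  differentiable f x -> differentiable (fun z => f z 0 j : R^o) x.
Proof.
move=> df; apply: (@differentiable_comp _ _ _ _ f (fun N : 'rV[R]_p => N 0 j : R^o)) => //.
exact: differentiable_coord.
Qed.

Lemma derive_row_coord (f : V -> 'rV[R]_p) (x v : V) (j : 'I_p) :
  differentiable f x -> ('D_v f x) 0 j = 'D_v (fun z => f z 0 j : R^o) x.
Proof.
by move=> df; rewrite derive_mx ?mxE//; exact: diff_derivable.
Qed.

End Coordinates.

Section CkTheory.
Context {R : realType} {V : normedModType R}.

Lemma Ck_sub (W : normedModType R) k (U U' : set V) (f : V -> W) :
  U' `<=` U -> Ck k U f -> Ck k U' f.
Proof.
move=> UU'; elim: k f => [|k IH] f /=; first by move=> cf x /UU'/cf.
by move=> [df Df]; split=> [x /UU'/df//|v]; exact: IH.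
Qed.

Lemma open_eq_near (W : Type) (U : set V) (f g : V -> W) x : open U -> U x ->
  {in U, f =1 g} -> \near x, f x = g x.
Proof.
move=> oU Ux fg; have : nbhs x U by apply: open_nbhs_nbhs.
by apply: filterS => y Uy; apply: fg; rewrite inE.
Qed.

(** A derivative at a point of [U] depends on a whole neighbourhood, which agreement on [U] covers
    because [U] is open. *)
Lemma Ck_ext (W : normedModType R) k (U : set V) (f g : V -> W) : open U ->
  {in U, f =1 g} -> Ck k U f -> Ck k U g.
Proof.
move=> oU; elim: k f g => [|k IH] f g fg /=.
  move=> cf x Ux; have : f y @[y --> x] --> f x := cf x Ux.
  rewrite fg ?inE//; apply: cvg_trans; apply: near_eq_cvg.
  by apply: open_eq_near oU Ux _ => y Uy; rewrite fg.
move=> [df Df]; split=> [x Ux|v].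
  by apply: near_eq_differentiable (df x Ux); exact: open_eq_near fg.
apply: IH (Df v) => x; rewrite inE => Ux.
by apply: near_eq_derive; exact: open_eq_near fg.
Qed.

Lemma CkS (W : normedModType R) k (U : set V) (f : V -> W) :
  Ck k.+1 U f -> Ck k U f.
Proof.
elim: k f => [|k IH] f; first by move=> [df _] x /df; exact: differentiable_continuous.
by move=> [df Df]; split=> // v; apply: IH; exact: Df.
Qed.

Lemma Ck_cst (W : normedModType R) k (U : set V) (w : W) : Ck k U (cst w).
Proof.
elim: k w => [|k IH] w /=; first by move=> x _; exact: cst_continuous.
split=> // v; have -> : (fun x => 'D_v (cst w) x) = cst 0; last exact: IH.
by apply/funext => x; rewrite derive_cst.
Qed.

Lemma Ck_add (W : normedModType R) k (U : set V) (f g : V -> W) : open U ->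
  Ck k U f -> Ck k U g -> Ck k U (fun x => f x + g x).
Proof.
move=> oU; elim: k f g => [|k IH] f g.
  by move=> cf cg x Ux; apply: continuousD; [exact: cf|exact: cg].
move=> [df Df] [dg Dg]; split=> [x Ux|v].
  by apply: differentiableD; [exact: df|exact: dg].
apply: (Ck_ext oU _ (IH _ _ (Df v) (Dg v))) => x; rewrite inE => Ux.
by rewrite -deriveD//; apply: diff_derivable; [exact: df|exact: dg].
Qed.

Lemma Ck_scale (W : normedModType R) k (U : set V) (a : V -> R^o) (f : V -> W) :
  open U -> Ck k U a -> Ck k U f -> Ck k U (fun x => a x *: f x).
Proof.
move=> oU; elim: k a f => [|k IH] a f.
  by move=> ca cf x Ux; apply: continuousZ; [exact: ca|exact: cf].
move=> Ca Cf; have [[da Da] [df Df]] := (Ca, Cf).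
split=> [x Ux|v]; first by apply: differentiable_scale; [exact: da|exact: df].
apply: (Ck_ext oU _ (Ck_add oU (IH _ _ (Da v) (CkS Cf)) (IH _ _ (CkS Ca) (Df v)))).
by move=> x; rewrite inE => Ux; rewrite derive_scale//; [exact: da|exact: df].
Qed.

Lemma Ck_sum (W : normedModType R) k (U : set V) n (f : 'I_n -> V -> W) :
  open U -> (forall i, Ck k U (f i)) -> Ck k U (fun x => \sum_i f i x).
Proof.
move=> oU; elim: n f => [|n IH] f Cf.
  by under eq_fun do rewrite big_ord0; exact: Ck_cst.
by under eq_fun do rewrite big_ord_recl; apply: Ck_add => //; exact: IH.
Qed.

Lemma Ck_coord p k (U : set V) (f : V -> 'rV[R]_p) j : open U ->
  Ck k U f -> Ck k U (fun x => f x 0 j : R^o).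
Proof.
move=> oU; elim: k f => [|k IH] f.
  move=> cf x Ux.
  by apply: (@continuous_comp _ _ _ f (fun N : 'rV[R]_p => N 0 j : R^o));
    [exact: cf|exact: coord_continuous].
move=> [df Df]; split=> [x Ux|v]; first exact/differentiable_row_coord/df.
apply: (Ck_ext oU _ (IH _ (Df v))) => x; rewrite inE => Ux.
by rewrite derive_row_coord//; exact: df.
Qed.

End CkTheory.

Lemma derive_comp_row (R : realType) (V W : normedModType R) p
    (f : V -> 'rV[R]_p) (g : 'rV[R]_p -> W) x v :
  differentiable f x -> differentiable g (f x) ->
  'D_v (g \o f) x = 'D_('D_v f x) g (f x).
Proof.
move=> df dg; rewrite !deriveE//; last exact: differentiable_comp.
by rewrite diff_comp.
Qed.

Lemma derive_sum_coord (R : realType) (W : normedModType R) p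
    (g : 'rV[R]_p -> W) x v :
  differentiable g x -> 'D_v g x = \sum_j v 0 j *: 'D_(delta_mx 0 j) g x.
Proof.
move=> dg; rewrite deriveE// {1}(row_sum_delta v) linear_sum/=.
by apply: eq_bigr => j _; rewrite linearZ/= deriveE.
Qed.

(** The chain rule differentiates [g] in the direction ['D_v f x], which varies with [x], whereas
    [Ck] controls constant directions. Expanding that direction in the standard basis gives a sum of
    products to which the induction applies. *)
Lemma Ck_comp (R : realType) (V W : normedModType R) p k (U : set V)
    (U' : set 'rV[R]_p) (f : V -> 'rV[R]_p) (g : 'rV[R]_p -> W) : open U ->
  (forall x, U x -> U' (f x)) -> Ck k U f -> Ck k U' g -> Ck k U (g \o f).
Proof.
move=> oU UU'; elim: k W g => [|k IH] W g.
  by move=> cf cg x Ux; apply: continuous_comp; [exact: cf|exact/cg/UU'].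
move=> Cf [dg Dg]; have [df Df] := Cf.
split=> [x Ux|v]; first by apply: differentiable_comp; [exact: df|exact/dg/UU'].
apply: (@Ck_ext _ _ _ _ _ (fun x =>
    \sum_j (('D_v f x) 0 j : R^o) *: ('D_(delta_mx 0 j) g \o f) x)) => //.
  move=> x; rewrite inE => Ux; rewrite derive_comp_row; [|exact: df|by apply: dg; exact: UU'].
  by rewrite derive_sum_coord//; apply: dg; exact: UU'.
apply: Ck_sum => // j; apply: Ck_scale => //; first exact: (Ck_coord j oU (Df v)).
by apply: IH; [exact: (CkS Cf)|exact: Dg].
Qed.

(** * Symmetry of second derivatives *)

Section Schwarz.
Context {R : realType} {V : normedModType R}.

Lemma derive_translate (W : normedModType R) (f : V -> W) (c x v : V) :
  'D_v (fun y => f (y + c)) x = 'D_v f (x + c).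
Proof.
by rewrite /derive/=; under eq_fun do rewrite -addrA.
Qed.

Lemma differentiable_translate (W : normedModType R) (f : V -> W) (c x : V) :
  differentiable f (x + c) -> differentiable (fun y => f (y + c)) x.
Proof.
by move=> df; apply: (@differentiable_comp _ _ _ _ (fun y => y + c) f).
Qed.

Lemma mean_value_line (f : V -> R^o) (y w : V) (h : R) : 0 < h ->
  (forall s, 0 <= s <= h -> differentiable f (y + s *: w)) ->
  exists2 s, 0 <= s <= h & f (y + h *: w) - f y = 'D_w f (y + s *: w) * h.
Proof.
move=> h0 df.
have dl s : differentiable (fun s : R => y + s *: w) s.
  exact: differentiableD.
have d1 s : 0 <= s <= h ->
    is_derive s 1 (fun s : R => f (y + s *: w) : R) ('D_w f (y + s *: w)).
  move=> sh; have dfl : differentiable (f \o (fun s : R => y + s *: w)) s.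
    by apply: differentiable_comp => //; exact: df.
  apply: DeriveDef; first exact: diff_derivable.
  rewrite deriveE// (@diff_comp _ _ _ _ (fun s : R => y + s *: w) f)//; last exact: df.
  rewrite /= [in RHS]deriveE; last exact: df.
  congr ('d f _ _); rewrite diffD//.
  by rewrite /= diff_cst diff_val /= add0r scale1r.
have [] := @MVT_segment R (fun s : R => f (y + s *: w))
  (fun s => 'D_w f (y + s *: w)) 0 h (ltW h0).
- by move=> s; rewrite in_itv/= => /andP[/ltW s0 /ltW sh]; apply: d1; rewrite s0 sh.
- apply: derivable_within_continuous => s; rewrite in_itv/= => sh.
  by have [] := d1 s sh.
- move=> s; rewrite in_itv/= scale0r addr0 subr0 => sh fE.
  by exists s.
Qed.

(** The left side is the increment along [h *: v] of [F y = f (y + h *: u) - f y]. One mean value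
    theorem for [F] along [v] and another for ['D_v f] along [u] produce the two factors [h]. *)
Lemma second_difference (f : V -> R^o) (U : set V) (x u v : V) (h : R) :
  open U -> Ck 2 U f -> 0 < h ->
  (forall s t, 0 <= s <= h -> 0 <= t <= h -> U (x + s *: u + t *: v)) ->
  exists s t, [/\ 0 <= s <= h, 0 <= t <= h &
    f (x + h *: u + h *: v) - f (x + h *: u) - f (x + h *: v) + f x
      = 'D_u (fun y => 'D_v f y) (x + s *: u + t *: v) * h * h].
Proof.
move=> oU [df Df] h0 Uh.
have hh : 0 <= h <= h by rewrite lexx ltW.
have h00 : 0 <= (0 : R) <= h by rewrite lexx ltW.
pose F y := f (y + h *: u) - f y.
have dF t : 0 <= t <= h ->
    differentiable (fun y => f (y + h *: u)) (x + t *: v) /\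
    differentiable f (x + t *: v).
  move=> th; split.
    by apply/differentiable_translate/df; rewrite addrAC; exact: Uh.
  by apply: df; have := Uh _ _ h00 th; rewrite scale0r addr0.
have [|t th tE] := @mean_value_line F x v h h0.
  by move=> t /dF[]; exact: differentiableB.
have DFE : 'D_v F (x + t *: v)
    = 'D_v f (x + t *: v + h *: u) - 'D_v f (x + t *: v).
  have [d1 d2] := dF t th.
  by rewrite /F deriveB ?derive_translate//; exact: diff_derivable.
have [|s sh sE] := @mean_value_line (fun y => 'D_v f y) (x + t *: v) u h h0.
  by move=> s sh; apply: (Df v).1; rewrite addrAC; exact: Uh.
exists s, t; split => //.
rewrite [x + s *: u + _]addrAC -sE -DFE -tE /F.
rewrite [x + h *: v + _]addrAC opprB addrA [RHS]addrAC; congr (_ + _).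
exact: addrAC.
Qed.

(** The second difference is symmetric in [u] and [v], so the two mixed derivatives coincide at
    points of a small parallelogram, possibly different ones. Both are continuous at [x], so they
    differ there by less than any [e]. *)
Lemma derive_swap (f : V -> R^o) (U : set V) (x u v : V) :
  open U -> U x -> Ck 2 U f ->
  'D_u (fun y => 'D_v f y) x = 'D_v (fun y => 'D_u f y) x.
Proof.
move=> oU Ux Cf; have [df Df] := Cf.
have Ca w w' : {for x, continuous (fun y => 'D_w (fun z => 'D_w' f z) y)}.
  exact: ((Df w').2 w x Ux).
apply/eqP; rewrite -subr_eq0 -normr_le0; apply/ler_addgt0Pl => e e0; rewrite addr0; apply/ltW.
have e2 : 0 < e / 2 by rewrite divr_gt0.
have /cvgrPdist_lt/(_ _ e2) A1 := Ca u v.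
have /cvgrPdist_lt/(_ _ e2) A2 := Ca v u.
have A3 : \forall y \near x, U y by apply: open_nbhs_nbhs.
have [r /= r0 br] := (nbhs_ballP _ _).1 (filterI (filterI A1 A2) A3).
(* With this [h] the parallelogram spanned by [h *: u] and [h *: v] at [x] stays in the ball of
   radius [r]; the [1] keeps the denominator positive when [u = v = 0]. *)
pose h := r / (`|u| + `|v| + 1).
have n0 : 0 < `|u| + `|v| + 1 by rewrite ltr_wpDl// addr_ge0.
have h0 : 0 < h by rewrite divr_gt0.
have inb s t : 0 <= s <= h -> 0 <= t <= h -> ball x r (x + s *: u + t *: v).
  move=> /andP[s0 sh] /andP[t0 th]; rewrite -ball_normE /ball_/=.
  rewrite -addrA opprD addrA subrr add0r normrN.
  apply: le_lt_trans (ler_normD _ _) _; rewrite !normrZ !ger0_norm//.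
  apply: (@le_lt_trans _ _ (h * (`|u| + `|v|))).
    by rewrite mulrDr lerD// ler_wpM2r.
  by rewrite /h mulrAC ltr_pdivrMr// ltr_pM2l// ltrDl.
have [|s [t [sh th E1]]] := @second_difference f U x u v h oU Cf h0.
  by move=> s t sh th; have [_] := br _ (inb s t sh th).
have [|t' [s' [th' sh' E2]]] := @second_difference f U x v u h oU Cf h0.
  by move=> t' s' th' sh'; rewrite addrAC; have [_] := br _ (inb s' t' sh' th').
(* Reordering terms turns the second difference for [v, u] into the one for [u, v]; both factors [h]
   then cancel. *)
move: E2; rewrite -!addrA [h *: v + _]addrC [- f (_ + _ *: v) + _]addrCA !addrA E1.
rewrite [x + t' *: v + _]addrAC => /(mulIf (lt0r_neq0 h0))/(mulIf (lt0r_neq0 h0)) E.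
have [[B1 _] _] := br _ (inb s t sh th).
have [[_ B2] _] := br _ (inb s' t' sh' th').
rewrite -(subrKA ('D_u (fun y => 'D_v f y) (x + s *: u + t *: v))) {2}E.
rewrite (splitr e); apply: le_lt_trans (ler_normD _ _) _.
by apply: ltrD; [exact: B1|rewrite distrC; exact: B2].
Qed.

End Schwarz.

Lemma derive_swap_row (R : realType) (V : normedModType R) p
    (f : V -> 'rV[R]_p) (U : set V) (x u v : V) : open U -> U x -> Ck 2 U f ->
  'D_u (fun y => 'D_v f y) x = 'D_v (fun y => 'D_u f y) x.
Proof.
move=> oU Ux Cf; have [df Df] := Cf.
have DE w w' j : ('D_w (fun y => 'D_w' f y) x) 0 j
    = 'D_w (fun y => 'D_w' (fun z => f z 0 j : R^o) y) x.
  rewrite derive_row_coord; last exact: (Df w').1.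
  apply: near_eq_derive; apply: (open_eq_near oU Ux) => y; rewrite inE => Uy.
  by rewrite derive_row_coord//; exact: df.
apply/rowP => j; rewrite [LHS]DE [RHS]DE.
exact: derive_swap oU Ux (Ck_coord j oU Cf).
Qed.

Lemma differentiable_sum_fun (R : realType) (V W : normedModType R) n
    (f : 'I_n -> V -> W) (x : V) : (forall i, differentiable (f i) x) ->
  differentiable (fun y => \sum_i f i y) x.
Proof.
move=> df; have := @differentiable_sum _ _ _ _ f x df.
by rewrite (_ : \sum_i f i = fun y => \sum_i f i y)//; apply/funext => y; rewrite fct_sumE.
Qed.

(* Sealed copies of 'D_v and 'J: with the transparent ones, unification tries to
   identify derivatives of different functions by unfolding limits. *)
HB.lock Definition der {R : realType} {V W : normedModType R} (v : V) (f : V -> W)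
  (x : V) : W := 'D_v f x.

HB.lock Definition jac {R : realType} {m n} (f : 'rV[R]_m -> 'rV[R]_n)
  (x : 'rV[R]_m) : 'M[R]_(m, n) := 'J f x.

Section SealedDerivatives.
Context {R : realType}.

Section General.
Context {V W : normedModType R}.
Implicit Types (f g : V -> W) (v x : V).

Lemma near_eq_der f g v x : (\near x, f x = g x) -> der v f x = der v g x.
Proof. by move=> fg; rewrite der.unlock; exact: near_eq_derive. Qed.

Lemma derD f g v x : differentiable f x -> differentiable g x ->
  der v (fun y => f y + g y) x = der v f x + der v g x.
Proof.
by move=> df dg; rewrite der.unlock; apply: deriveD; exact: diff_derivable.
Qed.

Lemma der_scale (a : V -> R^o) f v x : differentiable a x -> differentiable f x ->
  der v (fun y => a y *: f y) x = der v a x *: f x + a x *: der v f x.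
Proof. by move=> da df; rewrite der.unlock; exact: derive_scale. Qed.

Lemma der_cst (w : W) v x : der v (fun=> w) x = 0.
Proof. by rewrite der.unlock; exact: derive_cst. Qed.

Lemma der_linear f a u v x : differentiable f x ->
  der (a *: u + v) f x = a *: der u f x + der v f x.
Proof. by move=> df; rewrite der.unlock !deriveE// linearP. Qed.

Lemma der_scale_dir f a v x : differentiable f x ->
  der (a *: v) f x = a *: der v f x.
Proof. by move=> df; rewrite der.unlock !deriveE// linearZ. Qed.

Lemma der_sum n (f : 'I_n -> V -> W) v x :
  (forall i, differentiable (f i) x) ->
  der v (fun y => \sum_i f i y) x = \sum_i der v (f i) x.
Proof.
move=> df; rewrite der.unlock -derive_sum; last by move=> i; exact: diff_derivable.
by congr (derive _ _ _); apply/funext => y; rewrite fct_sumE.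
Qed.

Lemma Ck_der k (U : set V) f v : Ck k.+1 U f -> Ck k U (der v f).
Proof. by move=> [_ /(_ v)]; rewrite der.unlock. Qed.

Lemma Ck_diff k (U : set V) f x : U x -> Ck k.+1 U f -> differentiable f x.
Proof. by move=> Ux [+ _]; exact. Qed.

End General.

Lemma der_coord (V : normedModType R) p (f : V -> 'rV[R]_p) (x v : V) (j : 'I_p) :
  differentiable f x -> (der v f x) 0 j = der v (fun z => f z 0 j : R^o) x.
Proof. by move=> df; rewrite der.unlock; exact: derive_row_coord. Qed.

Lemma der_swap (V : normedModType R) p (f : V -> 'rV[R]_p) (U : set V) (x u v : V) :
  open U -> U x -> Ck 2 U f -> der u (der v f) x = der v (der u f) x.
Proof. by move=> oU Ux Cf; rewrite der.unlock; exact: derive_swap_row oU Ux Cf. Qed.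

Section Row.
Context {p : nat}.

Lemma der_comp (V W : normedModType R) (f : V -> 'rV[R]_p) (g : 'rV[R]_p -> W) x v :
  differentiable f x -> differentiable g (f x) ->
  der v (g \o f) x = der (der v f x) g (f x).
Proof. by move=> df dg; rewrite der.unlock; exact: derive_comp_row. Qed.

Lemma der_sum_coord (W : normedModType R) (g : 'rV[R]_p -> W) x v :
  differentiable g x -> der v g x = \sum_j v 0 j *: der (delta_mx 0 j) g x.
Proof. by move=> dg; rewrite der.unlock; exact: derive_sum_coord. Qed.

End Row.

Lemma der_jac m n (f : 'rV[R]_m -> 'rV[R]_n) x v :
  differentiable f x -> der v f x = v *m jac f x.
Proof. by move=> df; rewrite der.unlock jac.unlock; exact: deriveEjacobian. Qed.

Lemma row_jac m n (f : 'rV[R]_m -> 'rV[R]_n) x i :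
  differentiable f x -> row i (jac f x) = der (delta_mx 0 i) f x.
Proof. by move=> df; rewrite der_jac// rowE. Qed.

Lemma jac_comp m n p (f : 'rV[R]_m -> 'rV[R]_n) (g : 'rV[R]_n -> 'rV[R]_p) x :
  differentiable f x -> differentiable g (f x) ->
  jac (g \o f) x = jac f x *m jac g (f x).
Proof.
move=> df dg; have dgf := differentiable_comp df dg.
by apply/row_matrixP => i; rewrite row_mul !row_jac// der_comp// -der_jac.
Qed.

Lemma near_eq_jac m n (f g : 'rV[R]_m -> 'rV[R]_n) x :
  (\near x, f x = g x) -> differentiable f x -> jac f x = jac g x.
Proof.
move=> fg df; have dg := near_eq_differentiable fg df.
by apply/row_matrixP => i; rewrite !row_jac//; exact: near_eq_der.
Qed.

Lemma jac_id m (x : 'rV[R]_m) : jac id x = 1%:M.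
Proof.
by apply/row_matrixP => i; rewrite row1 row_jac// der.unlock derive_id.
Qed.

End SealedDerivatives.

(** * Charts and smooth fields *)

Section Charts.
Context {R : realType} {m : nat} {M : manifold R m}.
Implicit Types (x y p : M) (U : set M).

Lemma chart_image_open_sub U x : open U -> open (chart x @` (U `&` chart_dom x)).
Proof.
move=> oU; rewrite openE => _ [y [Uy dy] <-].
have nI : nbhs (chart x y) (chart x @` chart_dom x).
  by apply: open_nbhs_nbhs; split; [exact: chart_image_open|exists y].
have nU : nbhs (chart x y) (chart_inv x @^-1` U).
  apply: (chart_inv_continuous dy); rewrite chartK//.
  exact: open_nbhs_nbhs.
apply: filterS (filterI nI nU) => _ [[z dz <-]]; rewrite /= chartK// => Uz.
by exists z.
Qed.

(** Coordinates close to [chart x y] come from points of the manifold, so a local claim can be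
    checked at such points, where [chartK] removes the inverse chart. *)
Lemma near_chart U x (P : 'rV[R]_m -> Prop) y : open U -> U y -> chart_dom x y ->
  (forall z, U z -> chart_dom x z -> P (chart x z)) ->
  \forall s \near chart x y, P s.
Proof.
move=> oU Uy dy UP.
have : nbhs (chart x y) (chart x @` (U `&` chart_dom x)).
  by apply: open_nbhs_nbhs; split; [exact: chart_image_open_sub|exists y].
by apply: filterS => _ [z [Uz dz] <-]; exact: UP.
Qed.

Lemma transition_differentiable x y p : chart_dom x p -> chart_dom y p ->
  differentiable (chart y \o chart_inv x) (chart x p).
Proof.
move=> xp yp; have [+ _] := @chart_transition _ _ M x y 1.
by apply; exists p.
Qed.

Lemma transition_chain x y z p :
  chart_dom x p -> chart_dom y p -> chart_dom z p ->
  jac (chart z \o chart_inv x) (chart x p)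
  = jac (chart y \o chart_inv x) (chart x p)
    *m jac (chart z \o chart_inv y) (chart y p).
Proof.
move=> xp yp zp.
have yE : (chart y \o chart_inv x) (chart x p) = chart y p by rewrite /= chartK.
have d1 := transition_differentiable xp yp.
have d2 := transition_differentiable yp zp.
rewrite -{1}yE -jac_comp ?yE//.
apply: near_eq_jac; last exact: transition_differentiable.
apply: (near_chart (chart_dom_open y)) => // q yq xq.
by rewrite /= !(chartK xq) (chartK yq).
Qed.

Lemma transition_id x p : chart_dom x p ->
  jac (chart x \o chart_inv x) (chart x p) = 1%:M.
Proof.
move=> xp; rewrite -[RHS](jac_id (chart x p)); apply: near_eq_jac.
  by apply: (near_chart (chart_dom_open x)) => // q xq _; rewrite /= chartK.
exact: transition_differentiable.
Qed.

Lemma transitionK x y p : chart_dom x p -> chart_dom y p ->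
  jac (chart y \o chart_inv x) (chart x p)
    *m jac (chart x \o chart_inv y) (chart y p) = 1%:M.
Proof. by move=> xp yp; rewrite -transition_chain// transition_id. Qed.

Lemma tcoordE x y : tcoord x y = jac (chart x \o chart_inv y) (chart y y).
Proof. by rewrite jac.unlock. Qed.

Lemma tcoord_id x : tcoord x x = 1%:M :> 'M[R]_m.
Proof. by rewrite tcoordE transition_id//; exact: chart_dom_center. Qed.

Lemma dmap_id x : dmap (id : M -> M) x = 1%:M.
Proof. exact: tcoord_id. Qed.

End Charts.

Section SmoothMaps.
Context {R : realType} {m k : nat} {M : manifold R m} {N : manifold R k}.
Variable F : M -> N.
Hypothesis Fsm : smooth_map F.

Lemma dmapE x :
  dmap F x = jac (chart (F x) \o F \o chart_inv x) (chart x x).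
Proof. by rewrite jac.unlock. Qed.

Lemma smooth_map_preimage (c : N) : open (F @^-1` chart_dom c).
Proof. by have [/continuousP Fc _] := Fsm; apply: Fc; exact: chart_dom_open. Qed.

Lemma map_rep_open (U : set M) (x : M) (c : N) : open U ->
  open (chart x @` (U `&` chart_dom x `&` F @^-1` chart_dom c)).
Proof.
move=> oU; rewrite setIAC; apply: chart_image_open_sub.
by apply: openI => //; exact: smooth_map_preimage.
Qed.

Lemma map_rep_differentiable x c p : chart_dom x p -> chart_dom c (F p) ->
  differentiable (chart c \o F \o chart_inv x) (chart x p).
Proof.
move=> xp cp; have [_ /(_ x c 1) [+ _]] := Fsm.
by apply; exists p.
Qed.

Lemma jac_map_rep x y c d p :
  chart_dom x p -> chart_dom y p -> chart_dom c (F p) -> chart_dom d (F p) ->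
  jac (chart d \o F \o chart_inv x) (chart x p)
  = jac (chart y \o chart_inv x) (chart x p)
    *m jac (chart c \o F \o chart_inv y) (chart y p)
    *m jac (chart d \o chart_inv c) (chart c (F p)).
Proof.
move=> xp yp cp dp.
have yE : (chart y \o chart_inv x) (chart x p) = chart y p by rewrite /= chartK.
have cE : (chart c \o F \o chart_inv y) (chart y p) = chart c (F p).
  by rewrite /= chartK.
have d1 := transition_differentiable xp yp.
have d2 := map_rep_differentiable yp cp.
have d3 := transition_differentiable cp dp.
rewrite -{1}cE -mulmxA -jac_comp ?cE// -{1}yE -jac_comp ?yE//; last first.
  by apply: differentiable_comp => //; rewrite cE.
apply: near_eq_jac; last exact: map_rep_differentiable.
apply: (@near_chart _ _ _ (chart_dom y `&` F @^-1` chart_dom c)) => //.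
  by apply: openI; [exact: chart_dom_open|exact: smooth_map_preimage].
by move=> q [yq cq] xq; rewrite /= !(chartK xq) (chartK yq) (chartK cq).
Qed.

(** [dmap F p] is expressed in the charts centred at [p] and [F p], which move with [p]. In the
    fixed charts of [x] and [c] the transition Jacobians cancel, leaving the Jacobian of a single
    local expression of [F]. *)
Lemma push_rep (Y : M -> 'rV[R]_m) x c p : chart_dom x p -> chart_dom c (F p) ->
  local_rep F c x (fun y => Y y *m dmap F y) (chart x p)
  = local_rep (id : M -> M) x x Y (chart x p)
    *m jac (chart c \o F \o chart_inv x) (chart x p).
Proof.
move=> xp cp; rewrite /local_rep chartK// !tcoordE -!mulmxA; congr (_ *m _).
have pp := chart_dom_center p; have Fp := chart_dom_center (F p).
rewrite (jac_map_rep xp pp Fp cp) !mulmxA transitionK// mul1mx.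
by rewrite dmapE.
Qed.

End SmoothMaps.

Section SmoothFields.
Context {R : realType} {m k : nat} {M : manifold R m} {N : manifold R k}.
Variable F : M -> N.
Hypothesis Fsm : smooth_map F.
Implicit Types (U : set M) (Y Z : M -> 'rV[R]_k).

Lemma smooth_along_sub U U' Y : U' `<=` U ->
  smooth_along F U Y -> smooth_along F U' Y.
Proof.
move=> UU' sY x c j; apply: (Ck_sub _ (sY x c j)).
by move=> _ [p [[/UU' Up xp] cp] <-]; exists p.
Qed.

Lemma smooth_along_ext U Y Z : open U -> (forall x, U x -> Y x = Z x) ->
  smooth_along F U Y -> smooth_along F U Z.
Proof.
move=> oU YZ sY x c j; apply: (Ck_ext _ _ (sY x c j)); first exact: map_rep_open.
move=> s; rewrite inE => -[p [[Up xp] cp] <-].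
by rewrite /local_rep chartK// YZ.
Qed.

Lemma smooth_along_add U Y Z : open U ->
  smooth_along F U Y -> smooth_along F U Z ->
  smooth_along F U (fun x => Y x + Z x).
Proof.
move=> oU sY sZ x c j.
have oI := @map_rep_open _ _ _ _ _ _ Fsm U x c oU.
apply: (Ck_ext oI _ (Ck_add oI (sY x c j) (sZ x c j))) => s _.
by rewrite /local_rep mulmxDl.
Qed.

Lemma smooth_along_scale U (f : M -> R) Y : open U -> smooth_fun U f ->
  smooth_along F U Y -> smooth_along F U (fun x => f x *: Y x).
Proof.
move=> oU sf sY x c j.
have oI := @map_rep_open _ _ _ _ _ _ Fsm U x c oU.
have sfI : Ck j (chart x @` (U `&` chart_dom x `&` F @^-1` chart_dom c))
    (f \o chart_inv x : _ -> R^o).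
  by apply: (Ck_sub _ (sf x j)) => _ [p [Up _] <-]; exists p.
apply: (Ck_ext oI _ (Ck_scale oI sfI (sY x c j))) => s _.
by rewrite /local_rep scalemxAl.
Qed.

Lemma smooth_fun_sub U U' (f : M -> R) : U' `<=` U ->
  smooth_fun U f -> smooth_fun U' f.
Proof.
move=> UU' sf x j; apply: (Ck_sub _ (sf x j)).
by move=> _ [p [/UU' Up xp] <-]; exists p.
Qed.

Lemma smooth_fun_cst U (a : R) : smooth_fun U (fun=> a).
Proof. by move=> x j; exact: Ck_cst. Qed.

Lemma smooth_along_scale_cst U a Y : open U ->
  smooth_along F U Y -> smooth_along F U (fun x => a *: Y x).
Proof. by move=> oU; apply: smooth_along_scale => //; exact: smooth_fun_cst. Qed.

Lemma smooth_along_opp U Y : open U ->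
  smooth_along F U Y -> smooth_along F U (fun x => - Y x).
Proof.
move=> oU sY; apply: (smooth_along_ext oU _ (smooth_along_scale_cst (-1) oU sY)).
by move=> x _; rewrite scaleN1r.
Qed.

Lemma local_rep_differentiable U Y x c : U x -> chart_dom c (F x) ->
  smooth_along F U Y -> differentiable (local_rep F c x Y) (chart x x).
Proof.
move=> Ux cx sY; have [+ _] := sY x c 1; apply; exists x => //.
by split=> //; split=> //; exact: chart_dom_center.
Qed.

Lemma smooth_fun_differentiable U (f : M -> R) x : U x -> smooth_fun U f ->
  differentiable (f \o chart_inv x : _ -> R^o) (chart x x).
Proof.
move=> Ux sf; have [+ _] := sf x 1; apply; exists x => //.
by split=> //; exact: chart_dom_center.
Qed.

End SmoothFields.

Lemma smooth_map_id (R : realType) m (M : manifold R m) : smooth_map (id : M -> M).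
Proof.
split; first by move=> x; exact: cvg_id.
by move=> x y; exact: chart_transition.
Qed.

(** * Push-forward of vector fields and its torsion *)

Section Push.
Context {R : realType} {m k : nat} {M : manifold R m} {N : manifold R k}.
Variable F : M -> N.
Hypothesis Fsm : smooth_map F.

(** In fixed charts the push-forward is $\sum_i Y^i\,\partial_i\varphi$ with $\varphi$ the local
    expression of [F]. This costs one derivative of $\varphi$, hence the order [j.+1] in the
    proof. *)
Lemma smooth_push U (Y : M -> 'rV[R]_m) : open U -> smooth_field U Y ->
  smooth_along F U (fun y => Y y *m dmap F y).
Proof.
move=> oU sY x c j.
have oI := @map_rep_open _ _ _ _ _ _ Fsm U x c oU.
have sub1 : chart x @` (U `&` chart_dom x `&` F @^-1` chart_dom c)
    `<=` chart x @` (U `&` chart_dom x `&` id @^-1` chart_dom x).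
  by move=> _ [p [[Up xp] cp] <-]; exists p.
have CY := Ck_sub sub1 (sY x x j).
have Cphi : Ck j.+1 (chart x @` (U `&` chart_dom x `&` F @^-1` chart_dom c))
    (chart c \o F \o chart_inv x).
  have [_ /(_ x c j.+1)] := Fsm; apply: Ck_sub.
  by move=> _ [p [[Up xp] cp] <-]; exists p.
apply: (@Ck_ext _ _ _ _ _ (fun s => \sum_i
  (local_rep (id : M -> M) x x Y s 0 i : R^o) *:
     der (delta_mx 0 i) (chart c \o F \o chart_inv x) s)) => //.
  move=> s; rewrite inE => -[p [[Up xp] cp] <-]; rewrite push_rep//.
  have dphi := map_rep_differentiable Fsm xp cp.
  by rewrite -der_jac// [RHS]der_sum_coord.
apply: Ck_sum => // i; apply: Ck_scale => //; first exact: (Ck_coord i oI CY).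
exact: Ck_der.
Qed.

(** Leibniz rule for $\sum_i Y^i\,\partial_i\varphi$. The second summand is the Hessian of the local
    expression of [F] at [v] and [Y x], whose symmetry governs the torsion. *)
Lemma der_push U (Y : M -> 'rV[R]_m) x v : open U -> U x -> smooth_field U Y ->
  der v (local_rep F (F x) x (fun y => Y y *m dmap F y)) (chart x x)
  = der v (local_rep (id : M -> M) x x Y) (chart x x) *m dmap F x
    + \sum_i Y x 0 i *: der v (der (delta_mx 0 i)
        (chart (F x) \o F \o chart_inv x)) (chart x x).
Proof.
move=> oU Ux sY.
have xx := chart_dom_center x; have cx := chart_dom_center (F x).
have dphi := map_rep_differentiable Fsm xx cx.
have dY := local_rep_differentiable Ux xx sY.
have dYi i := differentiable_row_coord i dY.
have dD i : differentiable (der (delta_mx 0 i)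
    (chart (F x) \o F \o chart_inv x)) (chart x x).
  have [_ /(_ x (F x) 2)/Ck_der C1] := Fsm.
  by apply: (Ck_diff _ (C1 _)); exists x.
rewrite (@near_eq_der _ _ _ _ (fun s => \sum_i
  (local_rep (id : M -> M) x x Y s 0 i : R^o) *:
     der (delta_mx 0 i) (chart (F x) \o F \o chart_inv x) s)); last first.
  apply: (near_chart (smooth_map_preimage Fsm (F x))) => // p cp xp.
  rewrite push_rep//; have dp := map_rep_differentiable Fsm xp cp.
  by rewrite -der_jac// der_sum_coord.
rewrite der_sum; last by move=> i; exact: differentiable_scale.
under eq_bigr => i _ do rewrite der_scale//.
rewrite big_split/=; congr (_ + _); last first.
  by apply: eq_bigr => i _; rewrite {1}/local_rep chartK// tcoord_id mulmx1.
rewrite dmapE -der_jac// [RHS]der_sum_coord//.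
by apply: eq_bigr => i _; rewrite der_coord.
Qed.

Lemma cov_alongE (Gam : N -> 'rV[R]_k -> 'rV[R]_k -> 'rV[R]_k) x v
    (Y : M -> 'rV[R]_k) :
  cov_along Gam F x v Y
  = der v (local_rep F (F x) x Y) (chart x x) + Gam (F x) (v *m dmap F x) (Y x).
Proof. by rewrite der.unlock. Qed.

Lemma bracketE (X Y : M -> 'rV[R]_m) x : bracket X Y x =
  der (X x) (local_rep (id : M -> M) x x Y) (chart x x)
  - der (Y x) (local_rep (id : M -> M) x x X) (chart x x).
Proof. by rewrite der.unlock. Qed.

(** Antisymmetrising removes the Christoffel terms, symmetric by assumption, and the Hessian terms,
    symmetric by [der_swap]. What remains is the coordinate formula of the bracket, pushed
    forward. *)
Lemma torsion_push (Gam : N -> 'rV[R]_k -> 'rV[R]_k -> 'rV[R]_k) U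
    (X Y : M -> 'rV[R]_m) x :
  (forall p u v, Gam p u v = Gam p v u) -> open U -> U x ->
  smooth_field U X -> smooth_field U Y ->
  cov_along Gam F x (X x) (fun y => Y y *m dmap F y)
  - cov_along Gam F x (Y x) (fun y => X y *m dmap F y) = bracket X Y x *m dmap F x.
Proof.
move=> Gsym oU Ux sX sY.
have xx := chart_dom_center x; have cx := chart_dom_center (F x).
rewrite !cov_alongE (der_push _ oU Ux sY) (der_push _ oU Ux sX) bracketE.
rewrite [Gam _ (Y x *m _) _]Gsym opprD addrACA subrr addr0.
rewrite opprD addrACA -mulmxBl -[RHS]addr0; congr (_ + _).
apply/eqP; rewrite subr_eq0; apply/eqP.
have oI := @chart_image_open_sub _ _ _ _ x (smooth_map_preimage Fsm (F x)).
have Cphi : Ck 2 (chart x @` (F @^-1` chart_dom (F x) `&` chart_dom x))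
    (chart (F x) \o F \o chart_inv x).
  by rewrite setIC; have [_ /(_ x (F x) 2)] := Fsm.
have Ix : (chart x @` (F @^-1` chart_dom (F x) `&` chart_dom x)) (chart x x).
  by exists x.
have DE i v : der v (der (delta_mx 0 i)
      (chart (F x) \o F \o chart_inv x)) (chart x x)
    = \sum_j v 0 j *: der (delta_mx 0 j) (der (delta_mx 0 i)
      (chart (F x) \o F \o chart_inv x)) (chart x x).
  by apply: der_sum_coord; apply: (Ck_diff Ix (Ck_der _ Cphi)).
under eq_bigr => i _ do rewrite DE scaler_sumr.
under [RHS]eq_bigr => i _ do rewrite DE scaler_sumr.
rewrite exchange_big/=; apply: eq_bigr => i _; apply: eq_bigr => j _.
by rewrite !scalerA mulrC (der_swap _ _ oI Ix Cphi).
Qed.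

End Push.

(* The analysis library exports another [form]. *)
#[local] Notation form := Defs.form.

(** * Levi-Civita connections along a map *)

Section Bilinear.
Context {R : realType} {p : nat}.

Lemma linear_coords (V : lmodType R) (f : 'rV[R]_p -> V) (u : 'rV[R]_p) :
  linear f -> f u = \sum_i u 0 i *: f (delta_mx 0 i).
Proof.
move=> lf; pose fM := GRing.isLinear.Build _ _ _ _ _ lf.
pose fL : {linear _ -> _} := HB.pack f fM.
rewrite {1}(row_sum_delta u) -[f]/(fL : _ -> _) linear_sum.
by apply: eq_bigr => i _; rewrite linearZ.
Qed.

Lemma bilinear_coords (B : 'rV[R]_p -> 'rV[R]_p -> R^o) (u v : 'rV[R]_p) :
  (forall w, linear (B^~ w)) -> (forall w, linear (B w)) ->
  B u v = \sum_i \sum_j u 0 i *: (v 0 j *: B (delta_mx 0 i) (delta_mx 0 j)).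
Proof.
move=> Bl Br; rewrite (@linear_coords _ (B^~ v) u (Bl v)).
apply: eq_bigr => i _; rewrite (@linear_coords _ _ v (Br _)) scaler_sumr.
by [].
Qed.

Lemma form_linl (G : 'M[R]_p) a u u' v :
  form G (a *: u + u') v = a * form G u v + form G u' v.
Proof. by rewrite /form !mulmxDl -!scalemxAl !mxE. Qed.

Lemma form_addl (G : 'M[R]_p) u u' v : form G (u + u') v = form G u v + form G u' v.
Proof. by have := form_linl G 1 u u' v; rewrite scale1r mul1r. Qed.

Lemma form_linr (G : 'M[R]_p) a u v v' :
  form G u (a *: v + v') = a * form G u v + form G u v'.
Proof. by rewrite /form linearP/= mulmxDr -!scalemxAr !mxE. Qed.

Lemma form_addr (G : 'M[R]_p) u v v' : form G u (v + v') = form G u v + form G u v'.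
Proof. by have := form_linr G 1 u v v'; rewrite scale1r mul1r. Qed.

Lemma form_scaler (G : 'M[R]_p) a u v : form G u (a *: v) = a * form G u v.
Proof. by rewrite /form linearZ/= -scalemxAr mxE. Qed.

Lemma form_scalel (G : 'M[R]_p) a u v : form G (a *: u) v = a * form G u v.
Proof. by rewrite /form -!scalemxAl mxE. Qed.

Lemma form_subr (G : 'M[R]_p) u v v' : form G u (v - v') = form G u v - form G u v'.
Proof. by rewrite form_addr -scaleN1r form_scaler mulN1r. Qed.

Lemma form_subl (G : 'M[R]_p) u u' v : form G (u - u') v = form G u v - form G u' v.
Proof. by rewrite form_addl -scaleN1r form_scalel mulN1r. Qed.

End Bilinear.

Section CoordinateFields.
Context {R : realType} {m : nat} {M : manifold R m}.

(** The field with constant components [v] in the chart at [a]; the Jacobian rewrites them in the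
    chart centred at [p], where tangent vectors at [p] are recorded. *)
Definition coord_field (a : M) (v : 'rV[R]_m) (p : M) : 'rV[R]_m :=
  v *m jac (chart p \o chart_inv a) (chart a p).

Lemma coord_field_rep a v x c p : chart_dom a p -> chart_dom x p -> chart_dom c p ->
  local_rep (id : M -> M) c x (coord_field a v) (chart x p)
  = v *m jac (chart c \o chart_inv a) (chart a p).
Proof.
move=> ap xp cp; rewrite /local_rep chartK// /coord_field tcoordE -mulmxA.
by rewrite -transition_chain//; exact: chart_dom_center.
Qed.

Lemma coord_field_smooth a v : smooth_field (chart_dom a) (coord_field a v).
Proof.
move=> x c j.
have oI : open (chart x @` (chart_dom a `&` chart_dom x `&` id @^-1` chart_dom c)).
  by apply: map_rep_open; [exact: smooth_map_id|exact: chart_dom_open].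
apply: (@Ck_ext _ _ _ _ _
  (der v (chart c \o chart_inv a) \o (chart a \o chart_inv x))) => //.
  move=> s; rewrite inE => -[p [[ap xp] cp] <-]; rewrite coord_field_rep//.
  by rewrite /= chartK// der_jac//; exact: transition_differentiable.
apply: (@Ck_comp _ _ _ _ _ _ (chart a @` (chart_dom a `&` chart_dom c))) => //.
- by move=> _ [p [[ap xp] cp] <-]; rewrite /= chartK//; exists p.
- apply: Ck_sub (@chart_transition _ _ M x a j).
  by move=> _ [p [[ap xp] cp] <-]; exists p.
- by apply: Ck_der; exact: (@chart_transition _ _ M a c j.+1).
Qed.

Lemma coord_field_center a v : coord_field a v a = v.
Proof.
by rewrite /coord_field transition_id ?mulmx1//; exact: chart_dom_center.
Qed.

Lemma coord_field_linear a p : linear (fun v => coord_field a v p).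
Proof. by move=> c u v; rewrite /coord_field mulmxDl scalemxAl. Qed.

Lemma der_coord_field a v w :
  der w (local_rep (id : M -> M) a a (coord_field a v)) (chart a a) = 0.
Proof.
rewrite -[RHS](der_cst v w (chart a a)); apply: near_eq_der.
apply: (near_chart (chart_dom_open a)); try exact: chart_dom_center.
by move=> p ap _; rewrite coord_field_rep// transition_id// mulmx1.
Qed.

(** Constant components have no derivative, so only the Christoffel term survives. Evaluated on such
    fields, the two axioms of a Levi-Civita connection become the pointwise identities
    [levi_civita_sym] and [levi_civita_coef]. *)
Lemma cov_coord_field (Gam : M -> 'rV[R]_m -> 'rV[R]_m -> 'rV[R]_m) a w v :
  cov Gam a w (coord_field a v) = Gam a w v.
Proof.
by rewrite /cov cov_alongE der_coord_field add0r dmap_id mulmx1 coord_field_center.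
Qed.

Lemma dfunE (f : M -> R) x v : dfun f x v = der v (f \o chart_inv x : _ -> R^o) (chart x x).
Proof. by rewrite der.unlock. Qed.

Variables (g : M -> 'M[R]_m) (Gam : M -> 'rV[R]_m -> 'rV[R]_m -> 'rV[R]_m).
Hypothesis LC : levi_civita g Gam.

Lemma levi_civita_sym a u v : Gam a u v = Gam a v u.
Proof.
have [_ /(_ _ _ _ (chart_dom_open a) (coord_field_smooth a u)
  (coord_field_smooth a v) a (chart_dom_center a)) + _] := LC.
rewrite !coord_field_center !cov_coord_field bracketE !der_coord_field subrr.
by move/eqP; rewrite subr_eq0 => /eqP.
Qed.

Lemma levi_civita_coef a u v w :
  der w ((fun p => form (g p) (coord_field a u p) (coord_field a v p))
           \o chart_inv a : _ -> R^o) (chart a a)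
  = form (g a) (Gam a w u) v + form (g a) u (Gam a w v).
Proof.
have [_ _ /(_ _ _ _ (chart_dom_open a) (coord_field_smooth a u)
  (coord_field_smooth a v) a w (chart_dom_center a))] := LC.
by rewrite dfunE !coord_field_center !cov_coord_field.
Qed.

Lemma levi_civita_linear a w : linear (Gam a w).
Proof. by have [[_ H _] _ _] := LC; move=> c u v; rewrite H. Qed.

Lemma levi_civita_linearl a w : linear (Gam a ^~ w).
Proof. by have [[H _ _] _ _] := LC; move=> c u v; rewrite H. Qed.

End CoordinateFields.

Section MetricAlong.
Context {R : realType} {m k : nat} {M : manifold R m} {N : manifold R k}.
Variables (F : M -> N) (g : N -> 'M[R]_k).
Variable Gam : N -> 'rV[R]_k -> 'rV[R]_k -> 'rV[R]_k.
Hypothesis Fsm : smooth_map F.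
Hypothesis gL : lorentzian g.
Hypothesis LC : levi_civita g Gam.

Let G (a : N) (u v : 'rV[R]_k) : 'rV[R]_k -> R^o :=
  (fun p => form (g p) (coord_field a u p) (coord_field a v p)) \o chart_inv a.

Let G_linearl a v s : linear (fun u => G a u v s).
Proof. by move=> c u u'; rewrite /G/= coord_field_linear form_linl. Qed.

Let G_linearr a u s : linear (fun v => G a u v s).
Proof. by move=> c v v'; rewrite /G/= coord_field_linear form_linr. Qed.

(** Metricity is given for fields on [N], and fields along [F] need not extend to such fields. In
    the coordinate frame at [F x] the product is $\sum_{ij} Y^iZ^j\,(g_{ij}\circ F)$;
    differentiating it leaves only derivatives of the coefficients $g_{ij}$, which
    [levi_civita_coef] supplies. *)
Lemma metric_along U (Y Z : M -> 'rV[R]_k) x v : open U -> U x ->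
  smooth_along F U Y -> smooth_along F U Z ->
  dfun (fun y => form (g (F y)) (Y y) (Z y)) x v
  = form (g (F x)) (cov_along Gam F x v Y) (Z x)
    + form (g (F x)) (Y x) (cov_along Gam F x v Z).
Proof.
move=> oU Ux sY sZ; rewrite dfunE !cov_alongE; set a := F x.
have xx := chart_dom_center x; have aa : chart_dom a (F x) := chart_dom_center a.
set Yh := local_rep F a x Y; set Zh := local_rep F a x Z.
set phi := chart a \o F \o chart_inv x.
have YE : Yh (chart x x) = Y x.
  by rewrite /Yh /local_rep chartK// tcoord_id mulmx1.
have ZE : Zh (chart x x) = Z x.
  by rewrite /Zh /local_rep chartK// tcoord_id mulmx1.
have phiE : phi (chart x x) = chart a a by rewrite /phi /= chartK.
have dphi : differentiable phi (chart x x) by exact: map_rep_differentiable.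
have dY : differentiable Yh (chart x x) := local_rep_differentiable Ux aa sY.
have dZ : differentiable Zh (chart x x) := local_rep_differentiable Ux aa sZ.
have dG u w : differentiable (G a u w) (chart a a).
  have [_ _ sg] := gL.
  have sG := sg _ _ _ (chart_dom_open a) (coord_field_smooth a u)
    (coord_field_smooth a w).
  exact: smooth_fun_differentiable (chart_dom_center a) sG.
have dGphi u w : differentiable (G a u w \o phi) (chart x x).
  by apply: differentiable_comp => //; rewrite phiE.
pose e i : 'rV[R]_k := delta_mx 0 i.
pose term i j s : R^o :=
  (Yh s 0 i : R^o) *: ((Zh s 0 j : R^o) *: (G a (e i) (e j) \o phi) s).
have dYi i := differentiable_row_coord i dY.
have dZj j := differentiable_row_coord j dZ.
have dZG i j : differentiable (fun s => (Zh s 0 j : R^o) *: (G a (e i) (e j) \o phi) s)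
    (chart x x).
  exact: differentiable_scale.
have dterm i j : differentiable (term i j) (chart x x).
  exact: differentiable_scale.
rewrite (@near_eq_der _ _ _ _ (fun s => \sum_i \sum_j term i j s)); last first.
  apply: (near_chart (smooth_map_preimage Fsm a)) => // p ap xp.
  rewrite -(@bilinear_coords _ _ (fun u w => (G a u w \o phi) (chart x p)) _ _
    (fun w => G_linearl a w _) (fun w => G_linearr a w _)).
  rewrite /G /phi /= !chartK// /Yh /Zh /local_rep chartK// /coord_field.
  by rewrite !tcoordE -!mulmxA !transitionK ?mulmx1//; exact: chart_dom_center.
transitivity (\sum_i \sum_j der v (term i j) (chart x x)).
  transitivity (\sum_i der v (fun s => \sum_j term i j s) (chart x x)).
    by apply: der_sum => i; exact: differentiable_sum_fun.
  by apply: eq_bigr => i _; apply: der_sum.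
have dphiE : der v phi (chart x x) = v *m dmap F x by rewrite der_jac// dmapE.
have Gphi u w : (G a u w \o phi) (chart x x) = form (g a) u w.
  by rewrite /= phiE /G /= chartK// !coord_field_center.
have termE i j : der v (term i j) (chart x x) =
   (der v Yh (chart x x)) 0 i *: (Z x 0 j *: (form (g a) (e i) (e j) : R^o))
   + Y x 0 i *: ((der v Zh (chart x x)) 0 j *: (form (g a) (e i) (e j) : R^o))
   + Y x 0 i *: (Z x 0 j *: (form (g a) (Gam a (v *m dmap F x) (e i)) (e j)
                         + form (g a) (e i) (Gam a (v *m dmap F x) (e j)) : R^o)).
  rewrite /term der_scale// der_scale// der_comp// ?phiE// (levi_civita_coef LC).
  rewrite -!der_coord// YE ZE Gphi dphiE.
  by rewrite scalerDr addrA.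
under eq_bigr => i _ do under eq_bigr => j _ do rewrite termE scalerDr scalerDr.
under eq_bigr => i _ do rewrite !big_split/=.
rewrite !big_split/= !form_addl !form_addr.
set w := v *m dmap F x.
rewrite (@bilinear_coords _ _ (form (g a)) (der v Yh (chart x x)))
  ?(@bilinear_coords _ _ (form (g a)) _ (der v Zh (chart x x)))
  ?(@bilinear_coords _ _ (fun u u' => form (g a) (Gam a w u) u') (Y x))
  ?(@bilinear_coords _ _ (fun u u' => form (g a) u (Gam a w u')) (Y x)).
- by rewrite addrACA.
all: move=> w0 c u u'; by rewrite /= ?(levi_civita_linear LC) ?form_linl ?form_linr.
Qed.

End MetricAlong.

Section CovariantDerivative.
Context {R : realType} {m k : nat} {M : manifold R m} {N : manifold R k}.
Variables (F : M -> N).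
Variable Gam : N -> 'rV[R]_k -> 'rV[R]_k -> 'rV[R]_k.
Hypothesis Fsm : smooth_map F.
Hypothesis Gaml : forall p w, linear (Gam p ^~ w).
Hypothesis Gamr : forall p w, linear (Gam p w).
Implicit Types (U : set M) (Y Z : M -> 'rV[R]_k).

Lemma cov_along_linear U Y x a u v : U x -> smooth_along F U Y ->
  cov_along Gam F x (a *: u + v) Y
  = a *: cov_along Gam F x u Y + cov_along Gam F x v Y.
Proof.
move=> Ux sY; rewrite !cov_alongE der_linear; last first.
  exact: (local_rep_differentiable Ux (chart_dom_center _) sY).
by rewrite mulmxDl -scalemxAl Gaml scalerDr addrACA.
Qed.

Lemma cov_along_add U Y Z x v : U x -> smooth_along F U Y -> smooth_along F U Z ->
  cov_along Gam F x v (fun y => Y y + Z y)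
  = cov_along Gam F x v Y + cov_along Gam F x v Z.
Proof.
move=> Ux sY sZ; rewrite !cov_alongE.
have cx := chart_dom_center (F x).
have dY := local_rep_differentiable Ux cx sY.
have dZ := local_rep_differentiable Ux cx sZ.
have -> : local_rep F (F x) x (fun y => Y y + Z y)
    = fun s => local_rep F (F x) x Y s + local_rep F (F x) x Z s.
  by apply/funext => s; rewrite /local_rep mulmxDl.
rewrite derD// addrACA; congr (_ + _).
by rewrite -{1}[Y x]scale1r Gamr scale1r.
Qed.

Lemma cov_along_scale U (f : M -> R) Y x v : U x ->
  smooth_fun U f -> smooth_along F U Y ->
  cov_along Gam F x v (fun y => f y *: Y y)
  = dfun f x v *: Y x + f x *: cov_along Gam F x v Y.
Proof.
move=> Ux sf sY; rewrite !cov_alongE dfunE.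
have xx := chart_dom_center x; have cx := chart_dom_center (F x).
have dY := local_rep_differentiable Ux cx sY.
have df := smooth_fun_differentiable Ux sf.
have -> : local_rep F (F x) x (fun y => f y *: Y y)
    = fun s => ((f \o chart_inv x) s : R^o) *: local_rep F (F x) x Y s.
  by apply/funext => s; rewrite /local_rep scalemxAl.
rewrite der_scale//= scalerDr addrA; congr (_ + _ + _).
- by rewrite /local_rep chartK// tcoord_id mulmx1.
- by rewrite chartK.
have := Gamr (F x) (v *m dmap F x) (f x) (Y x) 0; rewrite !addr0 => ->.
(* Linearity is available only as an identity for [a *: u + v]; taking [-1, 0, 0] shows that [Gam]
   vanishes at zero. *)
have := Gamr (F x) (v *m dmap F x) (-1) 0 0; rewrite scaler0 addr0 scaleN1r addNr => ->.
by rewrite addr0.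
Qed.

Lemma cov_along_ext U Y Z x v : open U -> U x -> (forall y, U y -> Y y = Z y) ->
  cov_along Gam F x v Y = cov_along Gam F x v Z.
Proof.
move=> oU Ux YZ; rewrite !cov_alongE YZ//; congr (_ + _); apply: near_eq_der.
apply: (near_chart oU) => //; first exact: chart_dom_center.
by move=> p Up xp; rewrite /local_rep chartK// YZ.
Qed.

Lemma dfun_ext U (f h : M -> R) x v : open U -> U x -> (forall y, U y -> f y = h y) ->
  dfun f x v = dfun h x v.
Proof.
move=> oU Ux fh; rewrite !dfunE; apply: near_eq_der.
apply: (near_chart oU) => //; first exact: chart_dom_center.
by move=> p Up xp; rewrite /= chartK// fh.
Qed.

Lemma dfun_cst (a : R) x v : dfun (fun _ : M => a) x v = 0.
Proof. by rewrite dfunE; exact: (der_cst (a : R^o)). Qed.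

Lemma dfun_linear U (f : M -> R) x : U x -> smooth_fun U f ->
  linear (dfun f x : _ -> R^o).
Proof.
move=> Ux sf a u v; rewrite !dfunE der_linear//.
exact: smooth_fun_differentiable Ux sf.
Qed.

Lemma dfun_scale U (f : M -> R) x a v : U x -> smooth_fun U f ->
  dfun f x (a *: v) = a * dfun f x v.
Proof.
move=> Ux sf; have df := smooth_fun_differentiable Ux sf.
by rewrite !dfunE der_scale_dir.
Qed.

End CovariantDerivative.

Lemma form_comm (R : realType) p (G : 'M[R]_p) u v : G^T = G -> form G u v = form G v u.
Proof.
move=> GT; rewrite /form; have -> : u *m G *m v^T = (v *m G *m u^T)^T.
  by rewrite !trmx_mul trmxK GT mulmxA.
by rewrite mxE.
Qed.

(* In a Lorentz frame, [b - (b0 / a0) a] has no time component and is null. *)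
Lemma lorentz_null (R : realType) p (G A : 'M[R]_p.+1) (a b : 'rV[R]_p.+1) : A \in unitmx ->
  A *m G *m A^T = diag_mx (\row_(j < p.+1) if (j : nat) == 0%N then -1 else 1) ->
  G^T = G -> a != 0 -> form G a a = 0 -> form G a b = 0 -> form G b b = 0 ->
  exists c, b = c *: a.
Proof.
move=> uA AG GT a0 gaa gab gbb.
set D := diag_mx _ in AG.
have diagE (u : 'rV[R]_p.+1) :
    form D u u = - (u 0 0) ^+ 2 + \sum_(j < p) (u 0 (lift ord0 j)) ^+ 2.
  rewrite /form /D mxE big_ord_recl mul_mx_diag !mxE /=; congr (_ + _).
    by rewrite mulrN1 mulNr expr2.
  by apply: eq_bigr => j _; rewrite !mxE /= mulr1 expr2.
have formA (u v : 'rV[R]_p.+1) : form G u v = form D (u *m invmx A) (v *m invmx A).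
  by rewrite /form -AG trmx_mul !mulmxA mulmxKV// -(mulmxA _ A^T) -trmx_mul mulVmx// trmx1 mulmx1.
have time0 (u : 'rV[R]_p.+1) : u 0 0 = 0 -> form D u u = 0 -> u = 0.
  move=> u0; rewrite diagE u0 expr0n/= oppr0 add0r => /eqP.
  rewrite psumr_eq0 => [/allP u1|j _]; last exact: sqr_ge0.
  apply/rowP => j; rewrite mxE; case: (unliftP ord0 j) => [k|] ->//.
  by have := u1 k (mem_index_enum _); rewrite sqrf_eq0 => /eqP.
set a' := a *m invmx A; set b' := b *m invmx A.
have a'0 : a' 0 0 != 0.
  apply: contraNN a0 => /eqP a00; have : a' = 0 by apply: time0; rewrite -?formA.
  by move/(congr1 (mulmx^~ A)); rewrite /a' mulmxKV// mul0mx => ->.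
pose c := b' 0 0 / a' 0 0; exists c.
have time_coord (u v : 'rV[R]_p.+1) : (- c *: u + v) 0 0 = - c * u 0 0 + v 0 0.
  by rewrite !mxE.
have : - c *: a' + b' = 0.
  apply: time0; first by rewrite time_coord /c mulNr divfK// addNr.
  rewrite /a' /b' scalemxAl -mulmxDl -formA form_linl !form_linr gaa gab gbb.
  by rewrite form_comm// gab !(mulr0, addr0).
move/(congr1 (mulmx^~ A)); rewrite mulmxDl -scalemxAl /a' /b' !mulmxKV// mul0mx.
by rewrite scaleNr addrC => /eqP; rewrite subr_eq0 => /eqP.
Qed.

(** * Lightlike hypersurfaces and the induced connection *)

Section LightlikeGeometry.
Context {R : realType} {n : nat} (H : lightlike_hypersurface R n).
Variables (xi : H -> 'rV[R]_n.+1) (N : H -> 'rV[R]_n.+2).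
Hypothesis Hxi : spans_Rad xi.
Hypothesis HN : null_transversal xi N.
Implicit Types (x y : H) (U : set H) (X Y Z : H -> 'rV[R]_n.+1) (u v w : 'rV[R]_n.+1).

Local Notation i := (@Defs.incl R n H).
Local Notation gb x := (gbar (i x)).

Lemma gmx_sym x : (gmx x)^T = gmx x.
Proof.
have [gs _ _] := gbar_lorentzian H.
by rewrite /gmx /induced !trmx_mul trmxK gs mulmxA.
Qed.

Lemma form_gmx x u v :
  form (gmx x) u v = form (gb x) (u *m dmap i x) (v *m dmap i x).
Proof. by rewrite /form /gmx /induced trmx_mul !mulmxA. Qed.

Lemma RadP x v : reflect (exists c, v = c *: xi x) (v <= Rad x)%MS.
Proof.
have [_ /(_ x)[_ /eqmxP xiR]] := Hxi.
by rewrite -xiR; apply: sub_rVP.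
Qed.

Lemma form_Rad x u v : (v <= Rad x)%MS -> form (gmx x) u v = 0.
Proof.
move=> /sub_kermxP v0; rewrite form_comm ?gmx_sym// /form v0 mul0mx mxE.
by [].
Qed.

Lemma form_eq0_Rad x v : (forall u, form (gmx x) v u = 0) -> (v <= Rad x)%MS.
Proof.
move=> v0; apply/sub_kermxP/rowP => j.
have := v0 (delta_mx 0 j); rewrite /form trmx_delta -colE mxE => ->.
by rewrite mxE.
Qed.

Lemma xi_Rad x : (xi x <= Rad x)%MS.
Proof. by apply/RadP; exists 1; rewrite scale1r. Qed.

Lemma screen_Rad_decomp x v : exists2 s, (s <= screen x)%MS & exists c, v = s + c *: xi x.
Proof.
have [/andP[_ /(submx_trans (submx1 v))/sub_addsmxP[[a b] /= vE]] _] := screen_compl x.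
exists (a *m screen x); first exact: submxMl.
have /RadP[c cE] : (b *m Rad x <= Rad x)%MS by exact: submxMl.
by exists c; rewrite vE -cE.
Qed.

Lemma screen_Rad0 x v : (v <= screen x)%MS -> (v <= Rad x)%MS -> v = 0.
Proof.
move=> vs vr; have [_ I0] := screen_compl x.
by apply/eqP; rewrite -submx0 -I0 sub_capmx vs.
Qed.

(** A vector orthogonal to the screen is orthogonal to everything, the radical contributing nothing;
    it is then in the radical, which meets the screen in zero. *)
Lemma screen_nondegenerate x v : (v <= screen x)%MS ->
  (forall u, (u <= screen x)%MS -> form (gmx x) v u = 0) -> v = 0.
Proof.
move=> vs v0; apply: screen_Rad0 (vs) _; apply: form_eq0_Rad => w.
have [s ss [c ->]] := screen_Rad_decomp x w.
by rewrite form_addr v0// form_Rad ?addr0// scalemx_sub// xi_Rad.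
Qed.

End LightlikeGeometry.

Section InducedConnection.
Context {R : realType} {n : nat} {H : lightlike_hypersurface R n}.
Variables (xi : H -> 'rV[R]_n.+1) (N : H -> 'rV[R]_n.+2).
Hypothesis Hxi : spans_Rad xi.
Hypothesis HN : null_transversal xi N.
Implicit Types (x y : H) (U : set H) (X Y Z : H -> 'rV[R]_n.+1) (u v w : 'rV[R]_n.+1).

Local Notation i := (@Defs.incl R n H).
Local Notation eta := (@Defs.eta R n H).
Local Notation gb x := (gbar (i x)).

Lemma incl_inj_tangent x u v : u *m dmap i x = v *m dmap i x -> u = v.
Proof. exact: row_free_inj (incl_immersion x) _ _. Qed.

(** The Lorentz signature forces this: [xi] is null and orthogonal to all of $TM$, and in a
    Lorentzian space a null vector orthogonal to a nonzero null vector is a multiple of it. A null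
    [v] in the screen is thus also radical. *)
Lemma screen_anisotropic x v : (v <= screen x)%MS -> form (gmx x) v v = 0 -> v = 0.
Proof.
move=> vs vv; apply: screen_Rad0 (vs) _.
have [gs gA _] := gbar_lorentzian H.
have [A uA AG] := gA (i x).
have [_ /(_ x)[xi0 _]] := Hxi.
have xiR := xi_Rad Hxi x.
have [] := @lorentz_null _ _ _ _ (xi x *m dmap i x) (v *m dmap i x) uA AG (gs _).
- by apply: contraNN xi0 => /eqP E; apply/eqP/(@incl_inj_tangent x); rewrite E mul0mx.
- by rewrite -form_gmx form_Rad.
- by rewrite -form_gmx form_comm ?gmx_sym// form_Rad.
- by rewrite -form_gmx.
by move=> c; rewrite scalemxAl => /incl_inj_tangent ->; rewrite scalemx_sub.
Qed.

Lemma eta_linear x a u v : eta N x (a *: u + v) = a * eta N x u + eta N x v.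
Proof. by rewrite /eta mulmxDl -scalemxAl !mxE. Qed.

Lemma etaE x v : eta N x v = form (gb x) (v *m dmap i x) (N x).
Proof. by rewrite /eta /etamx /form !mulmxA. Qed.

Lemma eta_xi x : eta N x (xi x) = 1.
Proof.
have [gs _ _] := gbar_lorentzian H; have [_ /(_ x)[+ _ _]] := HN.
by rewrite etaE form_comm.
Qed.

Lemma eta_screen x v : (v <= screen x)%MS -> eta N x v = 0.
Proof.
have [gs _ _] := gbar_lorentzian H; have [_ /(_ x)[_ _ +]] := HN => Ns vs.
by rewrite etaE form_comm// Ns.
Qed.

Lemma eta0_screen x v : eta N x v = 0 -> (v <= screen x)%MS.
Proof.
have [s ss [c ->]] := screen_Rad_decomp Hxi x v.
rewrite addrC eta_linear eta_xi eta_screen// addr0 mulr1 => ->.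
by rewrite scale0r add0r.
Qed.

(** Makes the pseudo-inverse in [tan_part] cancel the frame on the right. Pairing a vanishing
    combination with [xi] kills its tangent part and isolates the coefficient of [N]; injectivity of
    the differential handles the rest. *)
Lemma row_free_frame x : row_free (col_mx (dmap i x) (N x)).
Proof.
have [gs _ _] := gbar_lorentzian H; have [_ /(_ x)[Nxi _ _]] := HN.
apply/row_freeP; apply/row_freeP; rewrite -kermx_eq0; apply/rowV0P => w /sub_kermxP.
rewrite -(hsubmxK w) mul_row_col; set a := lsubmx w; set b := rsubmx w => ab0.
have b0 : b = 0.
  rewrite [b]mx11_scalar; suff -> : b 0 0 = 0 by rewrite raddf0.
  have := congr1 (fun z => form (gb x) z (push xi x)) ab0.
  rewrite form_addl -form_gmx form_Rad ?(xi_Rad Hxi)// add0r.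
  have form0 : form (gb x) 0 (push xi x) = 0 by rewrite /form !mul0mx mxE.
  rewrite {1}[b]mx11_scalar mul_scalar_mx -[_ *: N x]addr0 form_linl Nxi form0.
  by rewrite mulr1 addr0.
move: ab0; rewrite b0 mul0mx addr0 -(mul0mx _ (dmap i x)) => /incl_inj_tangent ->.
by rewrite row_mx0.
Qed.

Lemma tan_part_tangent x v : tan_part N x (v *m dmap i x) = v.
Proof.
rewrite /tan_part.
have -> : v *m dmap i x = row_mx v 0 *m col_mx (dmap i x) (N x).
  by rewrite mul_row_col mul0mx addr0.
by rewrite mulmxKp ?row_free_frame// row_mxKl.
Qed.

Lemma tan_part_linear x : linear (tan_part N x).
Proof. by move=> a u v; rewrite /tan_part mulmxDl -scalemxAl linearP. Qed.

Hypothesis Hgeod : totally_geodesic H.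

(** Total geodesy makes the ambient derivative tangent, so [tan_part] loses nothing. It is stated
    for a field of directions; the coordinate field of [v], restricted to the chart, provides
    one. *)
Lemma nabla_push U Y x v : open U -> U x -> smooth_field U Y ->
  nabla N x v Y *m dmap i x = nabla_amb x v Y.
Proof.
move=> oU Ux sY; rewrite /nabla.
have oV : open (U `&` chart_dom x) by apply: openI => //; exact: chart_dom_open.
have sE : smooth_field (U `&` chart_dom x) (coord_field x v).
  by apply: smooth_along_sub (coord_field_smooth x v); exact: subIsetr.
have sYV : smooth_field (U `&` chart_dom x) Y.
  by apply: smooth_along_sub sY; exact: subIsetl.
have := Hgeod oV sE sYV (conj Ux (chart_dom_center x)).
rewrite coord_field_center => /submxP[w ->].
by rewrite tan_part_tangent.
Qed.

Let Gam_sym p (u v : 'rV[R]_n.+2) : @nabar R n H p u v = nabar p v u.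
Proof. exact: levi_civita_sym (nabar_levi_civita H) p u v. Qed.

Let Gam_linl p (w : 'rV[R]_n.+2) : linear (@nabar R n H p ^~ w).
Proof. exact: levi_civita_linearl (nabar_levi_civita H) p w. Qed.

Let Gam_linr p (w : 'rV[R]_n.+2) : linear (@nabar R n H p w).
Proof. exact: levi_civita_linear (nabar_levi_civita H) p w. Qed.

Let ism := @incl_smooth R n H.

Lemma nabla_linear U Y x : open U -> U x -> smooth_field U Y ->
  linear (fun v => nabla N x v Y).
Proof.
move=> oU Ux sY a u v.
rewrite /nabla -tan_part_linear; congr (tan_part N x _).
exact: cov_along_linear Gam_linl _ _ _ _ _ _ Ux (smooth_push ism oU sY).
Qed.

Lemma nabla_add U Y Z x v : open U -> U x -> smooth_field U Y -> smooth_field U Z ->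
  nabla N x v (fun y => Y y + Z y) = nabla N x v Y + nabla N x v Z.
Proof.
move=> oU Ux sY sZ; rewrite /nabla -[X in X + _]scale1r -tan_part_linear scale1r.
congr (tan_part N x _).
rewrite -(cov_along_add Gam_linr _ Ux (smooth_push ism oU sY) (smooth_push ism oU sZ)).
by congr cov_along; apply/funext => y; rewrite /push mulmxDl.
Qed.

Lemma nabla_scale U (f : H -> R) Y x v : open U -> U x ->
  smooth_fun U f -> smooth_field U Y ->
  nabla N x v (fun y => f y *: Y y) = dfun f x v *: Y x + f x *: nabla N x v Y.
Proof.
move=> oU Ux sf sY; rewrite -[in RHS](tan_part_tangent x (Y x)).
have -> : forall (a b : R) (p q : 'rV[R]_n.+2),
    a *: tan_part N x p + b *: tan_part N x q = tan_part N x (a *: p + b *: q).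
  move=> a b p q; rewrite tan_part_linear; congr (_ + _).
  have := tan_part_linear x b q 0; rewrite !addr0 => ->.
  have := tan_part_linear x (-1) 0 0; rewrite scaler0 addr0 scaleN1r addNr => ->.
  by rewrite addr0.
congr (tan_part N x _).
rewrite -(cov_along_scale Gam_linr _ Ux sf (smooth_push ism oU sY)).
by congr cov_along; apply/funext => y; rewrite /push scalemxAl.
Qed.

Lemma nabla_ext U Y Z x v : open U -> U x -> (forall y, U y -> Y y = Z y) ->
  nabla N x v Y = nabla N x v Z.
Proof.
move=> oU Ux YZ; congr (tan_part N x _).
by apply: cov_along_ext oU Ux _ => y Uy; rewrite /push YZ.
Qed.

Lemma nabla_torsion U X Y x : open U -> U x -> smooth_field U X -> smooth_field U Y ->
  nabla N x (X x) Y - nabla N x (Y x) X = bracket X Y x.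
Proof.
move=> oU Ux sX sY; apply: (@incl_inj_tangent x).
rewrite mulmxBl (nabla_push _ oU Ux sY) (nabla_push _ oU Ux sX).
exact: (torsion_push ism Gam_sym oU Ux sX sY).
Qed.

Lemma nabla_metric U Y Z x v : open U -> U x -> smooth_field U Y -> smooth_field U Z ->
  dfun (fun y => form (gmx y) (Y y) (Z y)) x v
  = form (gmx x) (nabla N x v Y) (Z x) + form (gmx x) (Y x) (nabla N x v Z).
Proof.
move=> oU Ux sY sZ.
have := metric_along ism (gbar_lorentzian H) (nabar_levi_civita H) v oU Ux
  (smooth_push ism oU sY) (smooth_push ism oU sZ).
rewrite -(nabla_push v oU Ux sY : _ = cov_along _ _ _ _ _).
rewrite -(nabla_push v oU Ux sZ : _ = cov_along _ _ _ _ _) -!form_gmx => <-.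
by congr dfun; apply/funext => y; rewrite form_gmx.
Qed.

End InducedConnection.

Section Idempotent.
Context {F : fieldType} {p : nat}.

(** Write $Q=CB$ with $C$, $B$ of full rank $r$. Idempotence reads $CBCB=CB$, and cancelling gives
    $BC=1$ of size $r$, with the same trace as $CB$. *)
Lemma mxtrace_idempotent (Q : 'M[F]_p) : Q *m Q = Q -> \tr Q = (\rank Q)%:R.
Proof.
move=> QQ; rewrite -{1}(mulmx_base Q) mxtrace_mulC.
suff -> : row_base Q *m col_base Q = 1%:M by rewrite mxtrace1.
apply: (row_full_inj (col_base_full Q)); apply: (row_free_inj (row_base_free Q)).
by rewrite mulmx1 mulmx_base mulmxA mulmx_base -mulmxA mulmx_base.
Qed.

End Idempotent.

(** * Eigendistributions *)

Section Splitting.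
Context {R : realType} {n : nat} {H : lightlike_hypersurface R n}.
Variables (xi : H -> 'rV[R]_n.+1) (N : H -> 'rV[R]_n.+2).
Hypothesis Hxi : spans_Rad xi.
Hypothesis HN : null_transversal xi N.
Implicit Types (x y : H) (U : set H) (X Y Z : H -> 'rV[R]_n.+1) (u v w : 'rV[R]_n.+1).

Local Notation eta := (@Defs.eta R n H).

(** The spectral hypotheses in a form symmetric in [alpha] and [beta], so that each lemma proved for
    one eigenfunction applies to the other through [eigensplit_sym]. *)
Definition eigensplit (S : H -> 'M[R]_n.+1) (lam0 : R) (alpha beta : H -> R) : Prop :=
  forall x, [/\ [/\ lam0 != alpha x, lam0 != beta x & alpha x != beta x],
    (eigenspace (S x) lam0 == Rad x)%MS
  & (eigenspace (S x) (alpha x) + eigenspace (S x) (beta x) == screen x)%MS].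

Lemma eigensplit_sym S lam0 alpha beta :
  eigensplit S lam0 alpha beta -> eigensplit S lam0 beta alpha.
Proof.
move=> H1 x; have [[n1 n2 n3] h1 h2] := H1 x; split=> //.
  by split=> //; rewrite eq_sym.
by rewrite addsmxC.
Qed.

Variables (S : H -> 'M[R]_n.+1) (lam0 : R) (alpha beta : H -> R).
Hypothesis split : eigensplit S lam0 alpha beta.

Local Notation Da x := (eigenspace (S x) (alpha x)).
Local Notation Db x := (eigenspace (S x) (beta x)).

Lemma eigen_screenl x v : (v <= Da x)%MS -> (v <= screen x)%MS.
Proof.
move=> va; have [_ _ /andP[+ _]] := split x; apply: submx_trans.
exact: submx_trans va (addsmxSl _ _).
Qed.

Lemma eigen_screenr x v : (v <= Db x)%MS -> (v <= screen x)%MS.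
Proof.
move=> va; have [_ _ /andP[+ _]] := split x; apply: submx_trans.
exact: submx_trans va (addsmxSr _ _).
Qed.

Lemma screen_eigen_decomp x v : (v <= screen x)%MS ->
  exists2 a, (a <= Da x)%MS & exists2 b, (b <= Db x)%MS & v = a + b.
Proof.
have [_ _ /andP[_ h]] := split x => /submx_trans/(_ h)/sub_addsmxP[[a b] /= ->].
by exists (a *m Da x); [exact: submxMl|exists (b *m Db x) => //; exact: submxMl].
Qed.

Lemma xi_eigen x : xi x *m S x = lam0 *: xi x.
Proof.
apply/eigenspaceP; have [_ /andP[_ h] _] := split x.
exact: submx_trans (xi_Rad Hxi x) h.
Qed.

Lemma screen_stable x v : (v <= screen x)%MS -> (v *m S x <= screen x)%MS.
Proof.
move=> /screen_eigen_decomp[a aa [b bb ->]].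
have /eigenspaceP aE := aa; have /eigenspaceP bE := bb.
rewrite mulmxDl aE bE addmx_sub// scalemx_sub//; first exact: eigen_screenl.
exact: eigen_screenr.
Qed.

Lemma frame_decomp x v :
  exists2 a, (a <= Da x)%MS & exists2 b, (b <= Db x)%MS &
    v = a + b + eta N x v *: xi x.
Proof.
have [s ss [c vE]] := screen_Rad_decomp Hxi x v.
have [a aa [b bb sE]] := screen_eigen_decomp ss.
exists a => //; exists b => //; rewrite -sE {1}vE; congr (_ + _ *: _).
rewrite vE addrC eta_linear (eta_xi HN) (eta_screen HN) //.
by rewrite addr0 mulr1.
Qed.

(** Kills the radical and the [beta]-eigenspace, and acts on the [alpha]-eigenspace as the nonzero
    scalar [(alpha x - lam0) * (alpha x - beta x)]: an unnormalised spectral projection. *)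
Definition eigenproj x : 'M[R]_n.+1 :=
  (S x - lam0%:M) *m (S x - (beta x)%:M).

Lemma mul_shift x v c : v *m (S x - c%:M) = v *m S x - c *: v.
Proof. by rewrite mulmxBr mul_mx_scalar. Qed.

Lemma eigenproj_vec x v c : v *m S x = c *: v ->
  v *m eigenproj x = ((c - lam0) * (c - beta x)) *: v.
Proof.
move=> vE; rewrite /eigenproj mulmxA (mul_shift x v) vE -scalerBl -scalemxAl mul_shift.
by rewrite vE -scalerBl scalerA.
Qed.

Lemma eigenprojE x v a b c : (a <= Da x)%MS -> (b <= Db x)%MS ->
  v = a + b + c *: xi x ->
  v *m eigenproj x = ((alpha x - lam0) * (alpha x - beta x)) *: a.
Proof.
move=> /eigenspaceP aE /eigenspaceP bE ->.
rewrite mulmxDl mulmxDl -scalemxAl (eigenproj_vec (xi_eigen x)).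
rewrite (eigenproj_vec aE) (eigenproj_vec bE) !subrr mulr0 mul0r.
by rewrite !scale0r scaler0 !addr0.
Qed.

Lemma eigenproj_sub x v : (v *m eigenproj x <= Da x)%MS.
Proof.
have [a aa [b bb vE]] := frame_decomp x v.
by rewrite (eigenprojE aa bb vE) scalemx_sub.
Qed.

Lemma eigenproj_eigen x v : (v <= Da x)%MS ->
  v *m eigenproj x = ((alpha x - lam0) * (alpha x - beta x)) *: v.
Proof.
move=> vv; apply: (@eigenprojE _ _ _ 0 0) => //; first exact: sub0mx.
by rewrite scale0r !addr0.
Qed.

Lemma eigen_scale_neq0 x : (alpha x - lam0) * (alpha x - beta x) != 0.
Proof.
have [[n1 n2 n3] _ _] := split x.
by rewrite mulf_neq0// subr_eq0// eq_sym.
Qed.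

(** The dimension of the [alpha]-eigenspace, taken as the rank of the spectral projection onto it so
    that [mxtrace_idempotent] expresses it as a trace. *)
Definition eigenmult x : nat :=
  \rank (((alpha x - lam0) * (alpha x - beta x))^-1 *: eigenproj x).

End Splitting.

(** * Multiplicities of the eigenfunctions and the trace of S *)

Section Multiplicities.
Context {R : realType} {n : nat} {H : lightlike_hypersurface R n}.
Variables (xi : H -> 'rV[R]_n.+1) (N : H -> 'rV[R]_n.+2).
Hypothesis Hxi : spans_Rad xi.
Hypothesis HN : null_transversal xi N.
Variables (S : H -> 'M[R]_n.+1) (lam0 : R) (alpha beta : H -> R).
Hypothesis split : eigensplit S lam0 alpha beta.

Local Notation eta := (@Defs.eta R n H).
Local Notation etamx := (@Defs.etamx R n H).

Let k al be (x : H) : R := (al x - lam0) * (al x - be x).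
Let Q al be (x : H) : 'M[R]_n.+1 := (k al be x)^-1 *: eigenproj S lam0 be x.

Let QE al be x v a b c : eigensplit S lam0 al be ->
  (a <= eigenspace (S x) (al x))%MS -> (b <= eigenspace (S x) (be x))%MS ->
  v = a + b + c *: xi x -> v *m Q al be x = a.
Proof.
move=> sp aa bb vE; rewrite /Q -scalemxAr (eigenprojE Hxi sp aa bb vE) scalerA.
by rewrite mulVf ?scale1r// (eigen_scale_neq0 sp).
Qed.

Let traceQ al be x : eigensplit S lam0 al be ->
  \tr (Q al be x) = (eigenmult S lam0 al be x)%:R.
Proof.
move=> sp; apply: mxtrace_idempotent; apply/row_matrixP => j; rewrite row_mul !rowE.
have [a aa [b bb vE]] := frame_decomp Hxi HN sp x (delta_mx 0 j).
rewrite (QE sp aa bb vE); apply: (@QE _ _ _ _ _ 0 0) => //; first exact: sub0mx.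
by rewrite scale0r !addr0.
Qed.

(** Trace of the resolution of the identity into spectral projections. The projection onto the
    radical is [etamx N x *m xi x], of trace $\eta(\xi)=1$, which accounts for [n] in place of
    [n.+1]. *)
Lemma eigenmult_sum x :
  eigenmult S lam0 alpha beta x + eigenmult S lam0 beta alpha x = n :> nat.
Proof.
have sp' := eigensplit_sym split.
have : 1%:M = Q alpha beta x + Q beta alpha x + etamx N x *m xi x.
  apply/row_matrixP => j; rewrite !linearD/= row_mul !rowE mulmx1 -mulmxA.
  rewrite mulmxA (mx11_scalar (_ *m etamx N x)) mul_scalar_mx.
  have [a aa [b bb vE]] := frame_decomp Hxi HN split x (delta_mx 0 j).
  have vE' := vE; rewrite [a + b]addrC in vE'.
  by rewrite (QE split aa bb vE) (QE sp' bb aa vE') -/(eta N x _) -vE.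
move/(congr1 mxtrace); rewrite !linearD/= !traceQ// mxtrace1 mxtrace_mulC.
have := eta_xi HN x; rewrite /Defs.eta => e1.
rewrite (mx11_scalar (xi x *m etamx N x)) e1 mxtrace1 -natr1.
by move/addIr; rewrite -natrD => /eqP; rewrite eqr_nat => /eqP.
Qed.

(** Trace of the spectral decomposition of [S x] with the same three projections, the radical one
    having trace one. *)
Lemma trace_eigenmult x : \tr (S x) = lam0 +
  alpha x *+ eigenmult S lam0 alpha beta x + beta x *+ eigenmult S lam0 beta alpha x.
Proof.
have sp' := eigensplit_sym split.
have : S x = alpha x *: Q alpha beta x + beta x *: Q beta alpha x
    + lam0 *: (etamx N x *m xi x).
  apply/row_matrixP => j; rewrite !rowE mulmxDr mulmxDr.
  rewrite -(scalemxAr (alpha x)) -(scalemxAr (beta x)) -(scalemxAr lam0) mulmxA (mx11_scalar (_ *m etamx N x)) mul_scalar_mx.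
  have [a aa [b bb vE]] := frame_decomp Hxi HN split x (delta_mx 0 j).
  have vE' := vE; rewrite [a + b]addrC in vE'.
  rewrite (QE split aa bb vE) (QE sp' bb aa vE').
  have /eigenspaceP aE := aa; have /eigenspaceP bE := bb.
  by rewrite {1}vE !mulmxDl -scalemxAl (xi_eigen Hxi split) aE bE !scalerA mulrC.
move/(congr1 mxtrace) => ->; rewrite !mxtraceD (mxtraceZ (alpha x)).
rewrite (mxtraceZ (beta x)) (mxtraceZ lam0) !traceQ// mxtrace_mulC.
have := eta_xi HN x; rewrite /Defs.eta => e1.
rewrite (mx11_scalar (xi x *m etamx N x)) e1 mxtrace1 mulr1 addrC addrA.
by rewrite !mulr_natr.
Qed.

Lemma eigenmult_gt0 x : eigenvalue (S x) (alpha x) ->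
  (0 < eigenmult S lam0 alpha beta x)%N.
Proof.
rewrite /eigenmult lt0n mxrank_eq0 => /eigenvalueP[v /eigenspaceP va v0].
apply: contraNN v0 => /eqP Q0; rewrite -(@QE alpha beta x v v 0 0)//.
- by rewrite /Q /k Q0 mulmx0.
- exact: sub0mx.
- by rewrite scale0r !addr0.
Qed.

End Multiplicities.

(** * Differentiating the trace identity *)

Section EigenDifferential.
Context {R : realType} {n : nat} {H : lightlike_hypersurface R n}.
Variables (xi : H -> 'rV[R]_n.+1) (N : H -> 'rV[R]_n.+2).
Hypothesis Hxi : spans_Rad xi.
Hypothesis HN : null_transversal xi N.
Implicit Types (x y : H) (U : set H) (X Y Z : H -> 'rV[R]_n.+1) (u v w : 'rV[R]_n.+1).

Local Notation eta := (@Defs.eta R n H).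

Lemma natr_dist_lt1 (a b : nat) : `|a%:R - b%:R : R| < 1 -> a = b.
Proof.
case: (ltngtP a b) => // ab.
- rewrite distrC ger0_norm ?subr_ge0 ?ler_nat 1?ltnW// ltrBlDl natr1 ltr_nat.
  by rewrite ltnS leqNgt ab.
- rewrite ger0_norm ?subr_ge0 ?ler_nat 1?ltnW// ltrBlDl natr1 ltr_nat.
  by rewrite ltnS leqNgt ab.
Qed.

Section TraceCondition.
Variables (S : H -> 'M[R]_n.+1) (lam0 : R) (alpha beta : H -> R) (c : R).
Hypothesis split : eigensplit S lam0 alpha beta.
Hypothesis salpha : smooth_fun [set: H] alpha.
Hypothesis sbeta : smooth_fun [set: H] beta.
Hypothesis beta_eig : forall x, eigenvalue (S x) (beta x).
Hypothesis traceS : forall x, \tr (S x) = c.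

(* The multiplicity of alpha is the continuous function
   [(c - lam0 - n beta) / (alpha - beta)], so it is locally constant and the
   trace identity can be differentiated. *)
Lemma dfun_eigen_trace x v : dfun alpha x v = 0 -> dfun beta x v = 0.
Proof.
move=> dalpha0.
have sp' := eigensplit_sym split.
pose r y := eigenmult S lam0 alpha beta y.
pose q y := eigenmult S lam0 beta alpha y.
have rq y : (r y)%:R + (q y)%:R = n%:R :> R.
  by rewrite -natrD -(eigenmult_sum Hxi HN split y).
have trE y : c = lam0 + alpha y * (r y)%:R + beta y * (q y)%:R.
  by rewrite -(traceS y) (trace_eigenmult Hxi HN split y) !mulr_natr.
have nab y : alpha y - beta y != 0.
  by have [[_ _ +] _ _] := split y; rewrite subr_eq0.
have rE y : (r y)%:R = (c - lam0 - n%:R * beta y) / (alpha y - beta y).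
  apply: (canRL (mulfK (nab y))).
  have qE : (q y)%:R = n%:R - (r y)%:R :> R by rewrite -(rq y); ring.
  by rewrite {1}(trE y) qE; ring.
have xx := chart_dom_center x.
have da := smooth_fun_differentiable (I : [set: H] x) salpha.
have db := smooth_fun_differentiable (I : [set: H] x) sbeta.
have ca := differentiable_continuous da.
have cb := differentiable_continuous db.
have cr : {for chart x x, continuous (fun s => (r (chart_inv x s))%:R : R^o)}.
  pose num s : R^o := c - lam0 - n%:R * beta (chart_inv x s).
  pose den s : R^o := (alpha (chart_inv x s) - beta (chart_inv x s))^-1.
  have -> : (fun s => (r (chart_inv x s))%:R : R^o) = (fun s => num s * den s).
    by apply/funext => s; rewrite rE.
  apply: continuousM.
    apply: continuousB; first exact: cst_continuous.
    by apply: continuousM; [exact: cst_continuous|exact: cb].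
  by apply: continuousV => //; apply: continuousB; [exact: ca|exact: cb].
have near_r : \forall s \near chart x x, r (chart_inv x s) = r x.
  move/cvgrPdist_lt : cr => /(_ 1 ltr01); apply: filterS => s /natr_dist_lt1.
  by rewrite chartK// => ->.
have near_q : \forall s \near chart x x,
    (alpha \o chart_inv x) s * (r x)%:R + (beta \o chart_inv x) s * (q x)%:R
    = c - lam0.
  apply: filterS near_r => s rs /=.
  have qs : (q (chart_inv x s))%:R = (q x)%:R :> R.
    by apply: (addrI (r (chart_inv x s))%:R); rewrite rq rs rq.
  by rewrite (trE (chart_inv x s)) rs qs; ring.
have : der v (fun s : 'rV[R]_n.+1 =>
     ((r x)%:R : R^o) *: ((alpha \o chart_inv x) s : R^o)
   + ((q x)%:R : R^o) *: ((beta \o chart_inv x) s : R^o)) (chart x x) = 0.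
  rewrite -[RHS](der_cst (c - lam0 : R^o) v (chart x x)); apply: near_eq_der.
  apply: filterS near_q => s <-.
  by rewrite [_ * (r x)%:R]mulrC [_ * (q x)%:R]mulrC.
rewrite derD; [|exact: differentiable_scale..].
rewrite der_scale// der_scale// !der_cst !scale0r !add0r -!dfunE dalpha0 scaler0 add0r.
move/eqP; rewrite scaler_eq0 pnatr_eq0 => /orP[/eqP q0|/eqP//].
by have := eigenmult_gt0 Hxi sp' (beta_eig x); rewrite -/(q x) q0.
Qed.

End TraceCondition.
End EigenDifferential.

(** * The derivative of an A-tensor *)

Section TensorDerivative.
Context {R : realType} {n : nat} {H : lightlike_hypersurface R n}.
Variables (xi : H -> 'rV[R]_n.+1) (N : H -> 'rV[R]_n.+2).
Hypothesis Hxi : spans_Rad xi.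
Hypothesis HN : null_transversal xi N.
Hypothesis Hgeod : totally_geodesic H.
Variable S : H -> 'M[R]_n.+1.
Hypothesis HS : A_tensor N S.
Implicit Types (x y : H) (U : set H) (X Y Z : H -> 'rV[R]_n.+1) (u v w : 'rV[R]_n.+1).

Local Notation eta := (@Defs.eta R n H).

Lemma smooth_S U Y : open U -> smooth_field U Y ->
  smooth_field U (fun y => Y y *m S y).
Proof. by have [sS _ _ _] := HS; exact: sS. Qed.

Lemma S_selfadjoint x u v : form (gmx x) (u *m S x) v = form (gmx x) u (v *m S x).
Proof. by have [_ _ + _] := HS. Qed.

(** [nablaS] with its direction given as a vector at [x], on whose value alone it depends; this lets
    linearity in the direction be stated. *)
Definition nabS x v Y : 'rV[R]_n.+1 :=
  nabla N x v (fun y => Y y *m S y) - nabla N x v Y *m S x.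

Lemma nablaSE X Y x : nablaS N S X Y x = nabS x (X x) Y.
Proof. by []. Qed.

Lemma nabS_linear U Y x : open U -> U x -> smooth_field U Y ->
  linear (fun v => nabS x v Y).
Proof.
move=> oU Ux sY a u v; rewrite /nabS (nabla_linear N oU Ux sY a u v).
rewrite (nabla_linear N oU Ux (smooth_S oU sY) a u v).
by rewrite mulmxDl -scalemxAl scalerBr opprD addrACA.
Qed.

Lemma nabS_add U Y Z x v : open U -> U x -> smooth_field U Y -> smooth_field U Z ->
  nabS x v (fun y => Y y + Z y) = nabS x v Y + nabS x v Z.
Proof.
move=> oU Ux sY sZ; rewrite /nabS (nabla_add N v oU Ux sY sZ).
rewrite mulmxDl opprD addrACA; congr (_ + _).
rewrite -(nabla_add N v oU Ux (smooth_S oU sY) (smooth_S oU sZ)).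
by congr nabla; apply/funext => y; rewrite mulmxDl.
Qed.

(** The two Leibniz terms $df(v)\,SY$ cancel, so $\nabla S$ is tensorial in its second argument. *)
Lemma nabS_scale U (f : H -> R) Y x v : open U -> U x ->
  smooth_fun U f -> smooth_field U Y ->
  nabS x v (fun y => f y *: Y y) = f x *: nabS x v Y.
Proof.
move=> oU Ux sf sY; rewrite /nabS (nabla_scale Hxi HN v oU Ux sf sY).
have -> : (fun y => f y *: Y y *m S y) = (fun y => f y *: (Y y *m S y)).
  by apply/funext => y; rewrite scalemxAl.
rewrite (nabla_scale Hxi HN v oU Ux sf (smooth_S oU sY)).
rewrite mulmxDl -!scalemxAl opprD addrACA subrr add0r.
by rewrite scalerBr.
Qed.

Section Eigenfields.
Variables (lam0 : R) (alpha beta : H -> R).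
Hypothesis split : eigensplit S lam0 alpha beta.
Hypothesis salpha : smooth_fun [set: H] alpha.
Hypothesis sbeta : smooth_fun [set: H] beta.

Local Notation Da x := (eigenspace (S x) (alpha x)).
Local Notation Db x := (eigenspace (S x) (beta x)).

Definition shift_field (f : H -> R) Y y := Y y *m S y - f y *: Y y.

Lemma smooth_shift_field (f : H -> R) U Y : open U -> smooth_fun U f ->
  smooth_field U Y -> smooth_field U (shift_field f Y).
Proof.
move=> oU sf sY; have idsm := smooth_map_id H.
apply: (smooth_along_add idsm oU (smooth_S oU sY)).
apply: (smooth_along_opp idsm oU).
exact: (smooth_along_scale idsm oU sf sY).
Qed.

Lemma eigenproj_shift x Y :
  shift_field beta (shift_field (fun=> lam0) Y) x = Y x *m eigenproj S lam0 beta x.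
Proof. by rewrite /eigenproj mulmxA !mul_shift. Qed.

(** The coordinate field of [v], sent through [eigenproj], stays smooth because [S] and [beta] are,
    and it takes values in the eigendistribution at every point. *)
Lemma eigen_extension x v : (v <= Da x)%MS ->
  exists Y, [/\ smooth_field (chart_dom x) Y, forall y, (Y y <= Da y)%MS & Y x = v].
Proof.
(* Normalising by the constant value at [x] is enough: the field only has to equal [v] there. *)
move=> va; pose k := ((alpha x - lam0) * (alpha x - beta x))^-1.
exists (fun y => k *: shift_field beta (shift_field (fun=> lam0) (coord_field x v)) y).
have oU := chart_dom_open x; split=> [|y|].
- apply: (smooth_along_scale_cst (smooth_map_id H) _ oU).
  apply: smooth_shift_field => //; first by apply: smooth_fun_sub sbeta.
  apply: smooth_shift_field => //; first exact: smooth_fun_cst.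
  exact: coord_field_smooth.
- by rewrite scalemx_sub// eigenproj_shift (eigenproj_sub Hxi HN split).
- rewrite eigenproj_shift coord_field_center (eigenproj_eigen Hxi split va) scalerA.
  by rewrite mulVf ?scale1r// (eigen_scale_neq0 split).
Qed.

(** Differentiating $SY=\alpha Y$ gives $(\nabla_vS)Y=d\alpha(v)Y+(\alpha-S)\nabla_vY$. By
    self-adjointness the last term is orthogonal to $D_\alpha$, a fact on which the later
    computations rest. *)
Lemma nabS_eigen U Y x v : open U -> U x -> in_dist (fun y => Da y) U Y ->
  nabS x v Y = dfun alpha x v *: Y x + (alpha x *: nabla N x v Y - nabla N x v Y *m S x).
Proof.
move=> oU Ux [sY Ya].
have sa : smooth_fun U alpha by apply: smooth_fun_sub salpha.
rewrite addrA -(nabla_scale Hxi HN v oU Ux sa sY); congr (_ - _).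
by apply: (nabla_ext N v oU Ux) => y /Ya/eigenspaceP.
Qed.

Lemma dfun_eigen_eq0 x v : (v <= Da x)%MS -> dfun alpha x v = 0.
Proof.
move=> va; have [Y [sY Ya Yx]] := eigen_extension va.
have oU := chart_dom_open x; have xx := chart_dom_center x.
have vs := eigen_screenl split va.
have [_ _ _ /(_ _ _ oU sY x xx)] := HS.
rewrite nablaSE /flat Yx (eta_screen HN vs) mul0r addr0.
rewrite (nabS_eigen _ oU xx) ?Yx; last by split.
set w := nabla _ _ _ _.
have vE : v *m S x = alpha x *: v by apply/eigenspaceP.
rewrite form_addr form_subr !form_scaler -S_selfadjoint vE form_scalel subrr addr0.
(* The defining condition has become $d\alpha(v)\,g(v,v)=0$. If the second factor vanishes, then
   $v=0$ by anisotropy, and $d\alpha(0)=0$. *)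
move/eqP; rewrite mulf_eq0 => /orP[/eqP//|/eqP/(screen_anisotropic Hxi vs) v0].
have := dfun_scale 0 v (I : [set: H] x) salpha.
by rewrite scale0r mul0r v0.
Qed.

End Eigenfields.
End TensorDerivative.

(** * The nondegenerate metric and its gradient *)

Section Gradient.
Context {R : realType} {n : nat} {H : lightlike_hypersurface R n}.
Variables (xi : H -> 'rV[R]_n.+1) (N : H -> 'rV[R]_n.+2).
Hypothesis Hxi : spans_Rad xi.
Hypothesis HN : null_transversal xi N.
Implicit Types (x y : H) (u v w : 'rV[R]_n.+1).

Local Notation eta := (@Defs.eta R n H).
Local Notation etamx := (@Defs.etamx R n H).

Lemma form_gtilde x u v : form (gtilde N x) u v = flat N x u v.
Proof.
rewrite /flat /gtilde /form mulmxDr mulmxDl mxE; congr (_ + _).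
rewrite mulmxA -mulmxA -trmx_mul /Defs.eta [LHS]mxE big_ord1.
by rewrite [X in _ * X]mxE.
Qed.

(** For [v] in the kernel, pairing with [xi] gives $\eta(v)=0$, so [v] lies in the screen; there
    $\tilde g$ agrees with the nondegenerate restriction of $g$. *)
Lemma gtilde_unit x : gtilde N x \in unitmx.
Proof.
rewrite -row_free_unit -kermx_eq0; apply/rowV0P => v /sub_kermxP v0.
have fl u : flat N x v u = 0 by rewrite -form_gtilde /form v0 mul0mx mxE.
have ev : eta N x v = 0.
  have := fl (xi x); rewrite /flat form_Rad ?(xi_Rad Hxi)// (eta_xi HN).
  by rewrite mulr1 add0r.
apply: (screen_nondegenerate Hxi (eta0_screen Hxi HN ev)) => u us.
by have := fl u; rewrite /flat ev mul0r addr0.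
Qed.

Lemma form_grad (f : H -> R) x v : smooth_fun [set: H] f ->
  flat N x (grad N f x) v = dfun f x v.
Proof.
move=> sf; rewrite -form_gtilde /form /grad mulmxKV ?gtilde_unit// mxE.
rewrite (linear_coords v (dfun_linear (I : [set: H] x) sf)).
by apply: eq_bigr => j _; rewrite !mxE mulrC.
Qed.

(** Since $\eta$ vanishes on the screen, $g(\nabla^gf,s)=\tilde g(\nabla^gf,s)=df(s)=0$ for [s] in
    the screen. The radical pairs to zero anyway, so the gradient is orthogonal to everything. *)
Lemma grad_Rad (f : H -> R) x : smooth_fun [set: H] f ->
  (forall v, (v <= screen x)%MS -> dfun f x v = 0) -> (grad N f x <= Rad x)%MS.
Proof.
move=> sf f0; apply: form_eq0_Rad => v.
have [s ss [c ->]] := screen_Rad_decomp Hxi x v.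
rewrite form_addr [form _ _ (_ *: _)]form_Rad ?scalemx_sub ?(xi_Rad Hxi)// addr0.
by have := form_grad x s sf; rewrite f0// /flat (eta_screen HN ss) mulr0 addr0.
Qed.

End Gradient.

(** A cubic with four zeros, here 0, 2, -1 and 1, has zero coefficients. *)
Lemma cubic_linear_coef (R : realFieldType) (p q r s : R) :
  (forall t, t * p + t ^+ 2 * q + r + t ^+ 3 * s = 0) -> p = 0.
Proof.
move=> h; have := h 1; have := h (-1); have := h 2; have := h 0; lra.
Qed.

(** * Polarisation of the A-tensor condition and screen-valuedness *)

Section Integrability.
Context {R : realType} {n : nat} {H : lightlike_hypersurface R n}.
Variables (xi : H -> 'rV[R]_n.+1) (N : H -> 'rV[R]_n.+2).
Hypothesis Hxi : spans_Rad xi.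
Hypothesis HN : null_transversal xi N.
Hypothesis Hgeod : totally_geodesic H.
Variable S : H -> 'M[R]_n.+1.
Hypothesis HS : A_tensor N S.
Variables (lam0 : R) (alpha beta : H -> R).
Hypothesis split : eigensplit S lam0 alpha beta.
Hypothesis salpha : smooth_fun [set: H] alpha.
Hypothesis sbeta : smooth_fun [set: H] beta.
Hypothesis dalpha : forall x v, (v <= screen x)%MS -> dfun alpha x v = 0.
Implicit Types (x y : H) (U : set H) (X Y Z : H -> 'rV[R]_n.+1) (u v w : 'rV[R]_n.+1).

Local Notation eta := (@Defs.eta R n H).
Local Notation Da := (fun x => eigenspace (S x) (alpha x)).
Local Notation Db := (fun x => eigenspace (S x) (beta x)).
Local Notation nabS := (nabS N S).
Local Notation g x := (form (gmx x)).

Lemma gmxC x u v : g x u v = g x v u.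
Proof. by rewrite form_comm ?gmx_sym. Qed.

Lemma eigen_orthogonal x a b : (a <= Da x)%MS -> (b <= Db x)%MS -> g x a b = 0.
Proof.
move=> /eigenspaceP aE /eigenspaceP bE; have [[_ _ nab] _ _] := split x.
have := S_selfadjoint HS x a b; rewrite aE bE form_scalel form_scaler.
by move/eqP; rewrite -subr_eq0 -mulrBl mulf_eq0 subr_eq0 (negPf nab) => /eqP.
Qed.

Lemma nabS_eigen_same U Y x v a : open U -> U x -> in_dist Da U Y ->
  (v <= screen x)%MS -> (a <= Da x)%MS -> g x (nabS x v Y) a = 0.
Proof.
move=> oU Ux dY vs /eigenspaceP aE.
rewrite (nabS_eigen Hxi HN salpha _ oU Ux dY) dalpha// scale0r add0r.
by rewrite form_subl form_scalel (S_selfadjoint HS) aE form_scaler subrr.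
Qed.

Lemma nabS_eigen_other U Y x v b : open U -> U x -> in_dist Da U Y ->
  (v <= screen x)%MS -> (b <= Db x)%MS ->
  g x (nabS x v Y) b = (alpha x - beta x) * g x (nabla N x v Y) b.
Proof.
move=> oU Ux dY vs /eigenspaceP bE.
rewrite (nabS_eigen Hxi HN salpha _ oU Ux dY) dalpha// scale0r add0r.
by rewrite form_subl form_scalel (S_selfadjoint HS) bE form_scaler mulrBl.
Qed.

Hypothesis Hstg : screen_totally_geodesic N.

(** The hypothesis $C=0$ concerns the projected field [Y y *m Pscr y], which agrees with [Y] on [U];
    the screen is the kernel of $\eta$. *)
Lemma nabla_screen U Y x v : open U -> U x -> in_dist (@screen R n H) U Y ->
  (nabla N x v Y <= screen x)%MS.
Proof.
move=> oU Ux [sY Ys]; apply: (eta0_screen Hxi HN).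
have oV : open (U `&` chart_dom x) by apply: openI => //; exact: chart_dom_open.
have sE : smooth_field (U `&` chart_dom x) (coord_field x v).
  by apply: smooth_along_sub (coord_field_smooth x v); exact: subIsetr.
have sYV : smooth_field (U `&` chart_dom x) Y.
  by apply: smooth_along_sub sY; exact: subIsetl.
have := Hstg oV sE sYV (conj Ux (chart_dom_center x)).
rewrite coord_field_center => E; rewrite -[RHS]E; congr (eta N x _).
apply: (nabla_ext N v oU Ux) => y Uy; rewrite proj_mx_id ?Ys//.
by have [_] := screen_compl y.
Qed.

(** Lets [screen_nondegenerate] conclude that $\nabla S$ vanishes from its $g$-products with the
    screen alone. *)
Lemma nabS_screen U Y x v : open U -> U x -> in_dist (@screen R n H) U Y ->
  (nabS x v Y <= screen x)%MS.
Proof.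
move=> oU Ux dY; have [sY Ys] := dY.
have dYS : in_dist (@screen R n H) U (fun y => Y y *m S y).
  split=> [|y Uy]; first exact: (smooth_S HS oU sY).
  exact: (screen_stable split (Ys y Uy)).
rewrite /nabS addmx_sub ?eqmx_opp//; first exact: nabla_screen oU Ux dYS.
by apply: (screen_stable split); exact: nabla_screen oU Ux dY.
Qed.

Lemma in_dist_eigen_screen U Y : in_dist Da U Y -> in_dist (@screen R n H) U Y.
Proof. by move=> [sY Ya]; split=> // y /Ya; exact: eigen_screenl split _ _. Qed.

Lemma in_dist_sub (D : H -> 'M[R]_n.+1) U U' Y :
  U' `<=` U -> in_dist D U Y -> in_dist D U' Y.
Proof.
move=> UU' [sY Ya]; split=> [|y /UU'/Ya//].
exact: smooth_along_sub UU' sY.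
Qed.

(** The A-tensor condition for the field $X+tZ$ with constant $t$, sorted by powers of $t$. *)
Lemma cubic_vanish U X Z x (t : R) : open U -> U x ->
  in_dist Da U X -> in_dist Db U Z ->
  t * (g x (Z x) (nabS x (X x) X) + g x (X x) (nabS x (Z x) X)
       + g x (X x) (nabS x (X x) Z))
  + t ^+ 2 * (g x (Z x) (nabS x (Z x) X) + g x (Z x) (nabS x (X x) Z)
       + g x (X x) (nabS x (Z x) Z))
  + g x (X x) (nabS x (X x) X) + t ^+ 3 * g x (Z x) (nabS x (Z x) Z) = 0.
Proof.
move=> oU Ux [sX Xa] [sZ Zb].
have idsm := smooth_map_id H.
have stZ := smooth_along_scale_cst idsm t oU sZ.
have sW := smooth_along_add idsm oU sX stZ.
have [_ _ _ /(_ _ _ oU sW x Ux)] := HS.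
have Ws : ((X x + t *: Z x)%R <= screen x)%MS.
  rewrite addmx_sub ?scalemx_sub//; first exact: (eigen_screenl split (Xa x Ux)).
  exact: (eigen_screenr split (Zb x Ux)).
rewrite nablaSE /flat => E; have {E} := E; rewrite (eta_screen HN Ws) mul0r addr0.
have nabW v : nabS x v (fun y => X y + t *: Z y) = nabS x v X + t *: nabS x v Z.
  rewrite (nabS_add HS v oU Ux sX stZ); congr (_ + _).
  exact: (nabS_scale Hxi HN HS v oU Ux (smooth_fun_cst U t) sZ).
have lin Y : smooth_field U Y ->
    nabS x (X x + t *: Z x) Y = nabS x (X x) Y + t *: nabS x (Z x) Y.
  by move=> sY; rewrite addrC (nabS_linear HS oU Ux sY) addrC.
rewrite nabW !lin//.
move: (nabS x (X x) X) (nabS x (Z x) X) (nabS x (X x) Z) (nabS x (Z x) Z).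
move: (X x) (Z x) => a b p q r s.
rewrite scalerDr !form_addl !form_addr !form_scalel !form_scaler => E.
by rewrite -[RHS]E; ring.
Qed.

(** The coefficient of $t$ above: the cyclic identity at $(X,X,Z)$. *)
Lemma nabS_polar U X Z x : open U -> U x -> in_dist Da U X -> in_dist Db U Z ->
  g x (Z x) (nabS x (X x) X) + g x (X x) (nabS x (Z x) X)
    + g x (X x) (nabS x (X x) Z) = 0.
Proof.
move=> oU Ux dX dZ.
by have /cubic_linear_coef := fun t => cubic_vanish t oU Ux dX dZ.
Qed.

(** The derivative of $g(X,Z)$, which is identically zero because eigenspaces of a self-adjoint [S]
    are orthogonal. *)
Lemma nabla_skew U X Z x v : open U -> U x -> in_dist Da U X -> in_dist Db U Z ->
  g x (nabla N x v X) (Z x) = - g x (X x) (nabla N x v Z).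
Proof.
move=> oU Ux [sX Xa] [sZ Zb]; apply/eqP; rewrite -addr_eq0.
rewrite -(nabla_metric Hxi HN Hgeod v oU Ux sX sZ).
rewrite (dfun_ext (h := fun=> 0) v oU Ux) ?dfun_cst// => y Uy.
exact: eigen_orthogonal (Xa y Uy) (Zb y Uy).
Qed.

End Integrability.

(** * Integrability of the eigendistributions against vanishing of nabla S *)

Section Equivalence.
Context {R : realType} {n : nat} {H : lightlike_hypersurface R n}.
Variables (xi : H -> 'rV[R]_n.+1) (N : H -> 'rV[R]_n.+2).
Hypothesis Hxi : spans_Rad xi.
Hypothesis HN : null_transversal xi N.
Hypothesis Hgeod : totally_geodesic H.
Variable S : H -> 'M[R]_n.+1.
Hypothesis HS : A_tensor N S.
Variable lam0 : R.
Hypothesis Hstg : screen_totally_geodesic N.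
Implicit Types (x y : H) (U : set H) (X Y Z : H -> 'rV[R]_n.+1) (u v w : 'rV[R]_n.+1).

Local Notation D al := (fun x => eigenspace (S x) (al x)).
Local Notation nabS := (nabS N S).
Local Notation g x := (form (gmx x)).

(** Everything known about the pair of eigenfunctions, symmetric under exchange, so that the lemmas
    below apply to both distributions. *)
Definition adapted (al be : H -> R) : Prop := [/\ eigensplit S lam0 al be,
  smooth_fun [set: H] al, smooth_fun [set: H] be,
  forall x v, (v <= screen x)%MS -> dfun al x v = 0
& forall x v, (v <= screen x)%MS -> dfun be x v = 0].

Lemma adapted_sym al be : adapted al be -> adapted be al.
Proof. by move=> [/eigensplit_sym]. Qed.

(** In the cyclic identity at $(X,X,Z)$ the term in direction $Z$ is zero, and by [nabla_skew] the
    other two are equal, so $2(\alpha-\beta)\,g(\nabla_XX,Z)=0$. *)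
Lemma nabS_diag_other al be U X Z x : adapted al be -> open U -> U x ->
  in_dist (D al) U X -> in_dist (D be) U Z ->
  g x (nabla N x (X x) X) (Z x) = 0.
Proof.
move=> G oU Ux dX dZ; have [sp sa sb da db] := G.
have sp' := eigensplit_sym sp.
have Xs := eigen_screenl sp (dX.2 x Ux).
have Zs := eigen_screenr sp (dZ.2 x Ux).
have := nabS_polar Hxi HN HS sp oU Ux dX dZ.
rewrite [g x (Z x) _]gmxC [g x (X x) (nabS x (Z x) X)]gmxC.
rewrite [g x (X x) (nabS x (X x) Z)]gmxC.
rewrite (nabS_eigen_same Hxi HN HS sa da oU Ux dX Zs (dX.2 x Ux)).
rewrite (nabS_eigen_other Hxi HN HS sa da oU Ux dX Xs (dZ.2 x Ux)).
rewrite (nabS_eigen_other Hxi HN HS sb db oU Ux dZ Xs (dX.2 x Ux)).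
rewrite [g x (nabla N x (X x) Z) _]gmxC.
rewrite (nabla_skew Hxi HN Hgeod HS sp (X x) oU Ux dX dZ).
have [[_ _ +] _ _] := sp x; rewrite -subr_eq0 => nab E.
move: E; set p := g x (X x) _; rewrite addr0; move: p => p E.
have : (al x - be x) * p = 0 by move: E; move: (al x) (be x) => a b; lra.
by move/eqP; rewrite mulf_eq0 (negPf nab) => /eqP ->; rewrite oppr0.
Qed.

Lemma nabla_eigen_other al be U X Y x b : adapted al be -> integrable_dist (D al) ->
  open U -> U x -> in_dist (D al) U X -> in_dist (D al) U Y -> (b <= D be x)%MS ->
  g x (nabla N x (X x) Y) b = 0.
Proof.
move=> G Ia oU Ux dX dY bb; have [sp sa sb da db] := G.
have [Z [sZ Zb Zx]] := eigen_extension Hxi HN HS (eigensplit_sym sp) sa bb.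
have oV : open (U `&` chart_dom x) by apply: openI => //; exact: chart_dom_open.
have Vx : (U `&` chart_dom x) x by split=> //; exact: chart_dom_center.
have dZ : in_dist (D be) (U `&` chart_dom x) Z.
  by split=> [|y _]; [apply: smooth_along_sub sZ; exact: subIsetr|exact: Zb].
have {}dX : in_dist (D al) (U `&` chart_dom x) X.
  by apply: in_dist_sub dX; exact: subIsetl.
have {}dY : in_dist (D al) (U `&` chart_dom x) Y.
  by apply: in_dist_sub dY; exact: subIsetl.
have [[sX Xa] [sY Ya]] := (dX, dY).
(* Polarisation: applying [nabS_diag_other] to $X$, $Y$ and $X+Y$ gives
   $g(\nabla_XY,Z)+g(\nabla_YX,Z)=0$, while the bracket in $D_\alpha$ makes the difference of these
   two terms vanish. *)
have dW : in_dist (D al) (U `&` chart_dom x) (fun y => X y + Y y).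
  split=> [|y Vy]; first exact: (smooth_along_add (smooth_map_id H) oV sX sY).
  by rewrite addmx_sub ?Xa ?Ya.
have Exx := nabS_diag_other G oV Vx dX dZ.
have Eyy := nabS_diag_other G oV Vx dY dZ.
have := nabS_diag_other G oV Vx dW dZ.
have linW W : smooth_field (U `&` chart_dom x) W ->
    nabla N x (X x + Y x) W = nabla N x (X x) W + nabla N x (Y x) W.
  move=> sW; have := nabla_linear N oV Vx sW 1 (X x) (Y x).
  by rewrite !scale1r.
rewrite (nabla_add N _ oV Vx sX sY) !linW// !form_addl Exx Eyy Zx.
have := eigen_orthogonal HS sp (Ia _ _ _ oV dX dY x Vx) bb.
rewrite -(nabla_torsion Hxi HN Hgeod oV Vx sX sY) form_subl.
set p := form _ (nabla N x (X x) Y) b; set q := form _ (nabla N x (Y x) X) b.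
by move: p q => p q; lra.
Qed.

Lemma nabS_integrable_same al be U X Y x : adapted al be -> integrable_dist (D al) ->
  open U -> U x -> in_dist (D al) U X -> in_dist (D al) U Y ->
  nabS x (X x) Y = 0.
Proof.
move=> G Ia oU Ux dX dY; have [sp sa sb da db] := G.
have dYs := in_dist_eigen_screen sp dY.
have Xs := eigen_screenl sp (dX.2 x Ux).
apply: (screen_nondegenerate Hxi (nabS_screen Hxi HN HS sp Hstg (X x) oU Ux dYs)).
move=> u /(screen_eigen_decomp sp)[a aa [b bb ->]]; rewrite form_addr.
rewrite (nabS_eigen_same Hxi HN HS sa da oU Ux dY Xs aa) add0r.
rewrite (nabS_eigen_other Hxi HN HS sa da oU Ux dY Xs bb).
by rewrite (nabla_eigen_other G Ia oU Ux dX dY bb) mulr0.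
Qed.

(** Only test vectors in $D_\alpha$ matter. Extending one to a section $Z$, [nabla_skew] moves the
    derivative from $Y$ to $Z$, and $g(\nabla_XZ,Y)=0$ by [nabla_eigen_other]. *)
Lemma nabS_integrable_other al be U X Y x : adapted al be -> integrable_dist (D al) ->
  open U -> U x -> in_dist (D al) U X -> in_dist (D be) U Y ->
  nabS x (X x) Y = 0.
Proof.
move=> G Ia oU Ux dX dY; have [sp sa sb da db] := G.
have sp' := eigensplit_sym sp.
have dYs := in_dist_eigen_screen sp' dY.
have Xs := eigen_screenl sp (dX.2 x Ux).
apply: (screen_nondegenerate Hxi (nabS_screen Hxi HN HS sp' Hstg (X x) oU Ux dYs)).
move=> u /(screen_eigen_decomp sp)[a aa [b bb ->]]; rewrite form_addr.
rewrite (nabS_eigen_same Hxi HN HS sb db oU Ux dY Xs bb) addr0.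
rewrite (nabS_eigen_other Hxi HN HS sb db oU Ux dY Xs aa).
have [Z [sZ Za Zx]] := eigen_extension Hxi HN HS sp sb aa.
have oV : open (U `&` chart_dom x) by apply: openI => //; exact: chart_dom_open.
have Vx : (U `&` chart_dom x) x by split=> //; exact: chart_dom_center.
have dZ : in_dist (D al) (U `&` chart_dom x) Z.
  by split=> [|y _]; [apply: smooth_along_sub sZ; exact: subIsetr|exact: Za].
have {}dX : in_dist (D al) (U `&` chart_dom x) X.
  by apply: in_dist_sub dX; exact: subIsetl.
have dY' : in_dist (D be) (U `&` chart_dom x) Y.
  by apply: in_dist_sub dY; exact: subIsetl.
have := nabla_skew Hxi HN Hgeod HS sp (X x) oV Vx dZ dY'.
rewrite (nabla_eigen_other G Ia oV Vx dX dZ (dY.2 x Ux)) Zx gmxC.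
by move/eqP; rewrite eq_sym oppr_eq0 => /eqP ->; rewrite mulr0.
Qed.

Lemma shift_field_eigen al be x v : eigensplit S lam0 al be ->
  (v <= screen x)%MS -> ((v *m S x - be x *: v)%R <= D al x)%MS.
Proof.
move=> sp /(screen_eigen_decomp sp)[a aa [b bb ->]].
have /eigenspaceP aE := aa; have /eigenspaceP bE := bb.
rewrite mulmxDl aE bE scalerDr opprD addrACA subrr addr0 -scalerBl.
exact: scalemx_sub.
Qed.

Lemma in_dist_shift_field al be U Y : eigensplit S lam0 al be ->
  smooth_fun [set: H] be -> open U -> in_dist (@screen R n H) U Y ->
  in_dist (D al) U (shift_field S be Y).
Proof.
move=> sp sb oU [sY Ys]; split=> [|y Uy].
  by apply: (smooth_shift_field HS oU _ sY); apply: smooth_fun_sub sb.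
exact: shift_field_eigen sp (Ys y Uy).
Qed.

Lemma nabS_shift_field f U Y x v : open U -> U x -> smooth_fun [set: H] f ->
  smooth_field U Y ->
  nabS x v (shift_field S f Y) = nabS x v (fun y => Y y *m S y) - f x *: nabS x v Y.
Proof.
move=> oU Ux sf sY; have idsm := smooth_map_id H.
have sfU : smooth_fun U f by apply: smooth_fun_sub sf.
have sfY := smooth_along_scale idsm oU sfU sY.
rewrite -(nabS_scale Hxi HN HS v oU Ux sfU sY) -scaleN1r.
rewrite -(nabS_scale Hxi HN HS v oU Ux (smooth_fun_cst U (-1)) sfY).
rewrite -(nabS_add HS v oU Ux (smooth_S HS oU sY)
  (smooth_along_scale_cst idsm (-1) oU sfY)).
by congr (nabS x v _); apply/funext => y; rewrite scaleN1r.
Qed.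

(** Applied with [p] the value of a linear quantity at a screen field and [q] its value at [S] times
    that field: the hypotheses then say that it vanishes on the shifted fields, which lie in the two
    eigendistributions. *)
Lemma eigen_separate (a b : R) (p q : 'rV[R]_n.+1) : a != b ->
  q - a *: p = 0 -> q - b *: p = 0 -> p = 0.
Proof.
move=> nab /eqP; rewrite subr_eq0 => /eqP -> /eqP.
by rewrite -scalerBl scaler_eq0 subr_eq0 (negPf nab) => /eqP.
Qed.

Lemma nabS_screen_dir al be U X Y x : adapted al be -> open U -> U x ->
  in_dist (@screen R n H) U X -> smooth_field U Y ->
  (forall Z, in_dist (D al) U Z -> nabS x (Z x) Y = 0) ->
  (forall Z, in_dist (D be) U Z -> nabS x (Z x) Y = 0) -> nabS x (X x) Y = 0.
Proof.
move=> [sp sa sb _ _] oU Ux dX sY Ha Hb; have [[_ _ nab] _ _] := sp x.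
have shiftE c : nabS x (X x *m S x - c *: X x) Y
    = nabS x (X x *m S x) Y - c *: nabS x (X x) Y.
  by rewrite addrC -scaleNr (nabS_linear HS oU Ux sY) scaleNr addrC.
apply: (eigen_separate nab (q := nabS x (X x *m S x) Y)).
  rewrite -shiftE; apply: (Hb (shift_field S al X)).
  exact: in_dist_shift_field (eigensplit_sym sp) sa oU dX.
rewrite -shiftE; apply: (Ha (shift_field S be X)).
exact: in_dist_shift_field sp sb oU dX.
Qed.

Lemma integrable_nabS_eq0 al be U X Y x : adapted al be ->
  integrable_dist (D al) -> integrable_dist (D be) -> open U -> U x ->
  in_dist (@screen R n H) U X -> in_dist (@screen R n H) U Y ->
  nabS x (X x) Y = 0.
Proof.
move=> G Ia Ib oU Ux dX dY; have G' := adapted_sym G.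
have [sp sa sb _ _] := G; have [[_ _ nab] _ _] := sp x.
have dYa := in_dist_shift_field sp sb oU dY.
have dYb := in_dist_shift_field (eigensplit_sym sp) sa oU dY.
(* The second argument is separated here and the direction in [nabS_screen_dir], leaving the four
   combinations of eigendistributions. *)
apply: (eigen_separate nab (q := nabS x (X x) (fun y => Y y *m S y))).
  rewrite -(nabS_shift_field _ oU Ux sa dY.1).
  apply: (nabS_screen_dir G oU Ux dX dYb.1) => Z dZ.
    exact: nabS_integrable_other G Ia oU Ux dZ dYb.
  exact: nabS_integrable_same G' Ib oU Ux dZ dYb.
rewrite -(nabS_shift_field _ oU Ux sb dY.1).
apply: (nabS_screen_dir G oU Ux dX dYa.1) => Z dZ.
  exact: nabS_integrable_same G Ia oU Ux dZ dYa.
exact: nabS_integrable_other G' Ib oU Ux dZ dYa.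
Qed.

(** With $d\alpha=0$ on the screen, $\nabla S=0$ says $S\nabla_ZW=\alpha\nabla_ZW$ for sections $Z$,
    $W$ of $D_\alpha$. So $\nabla$ preserves sections along $D_\alpha$, and the torsion-free formula
    for the bracket concludes. *)
Lemma nabS_eq0_integrable al be : adapted al be ->
  (forall U X Y, open U -> in_dist (@screen R n H) U X ->
     in_dist (@screen R n H) U Y -> forall x, U x -> nabS x (X x) Y = 0) ->
  integrable_dist (D al).
Proof.
move=> [sp sa _ da _] nab0 U X Y oU dX dY x Ux.
have nablaE Z W : in_dist (D al) U Z -> in_dist (D al) U W ->
    (nabla N x (Z x) W <= D al x)%MS.
  move=> dZ dW; apply/eigenspaceP.
  have := nab0 U Z W oU (in_dist_eigen_screen sp dZ) (in_dist_eigen_screen sp dW) x Ux.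
  rewrite (nabS_eigen Hxi HN sa _ oU Ux dW) da; last first.
    exact: (eigen_screenl sp (dZ.2 x Ux)).
  by rewrite scale0r add0r => /eqP; rewrite subr_eq0 => /eqP.
rewrite -(nabla_torsion Hxi HN Hgeod oU Ux dX.1 dY.1).
by rewrite addmx_sub ?eqmx_opp ?nablaE.
Qed.

End Equivalence.

Theorem theorem6p1 (R : realType) (n : nat) (H : lightlike_hypersurface R n)
    (xi : H -> 'rV[R]_n.+1) (N : H -> 'rV[R]_n.+2) (S : H -> 'M[R]_n.+1)
    (lam0 : R) (alpha beta : H -> R)
    (Hconn : connected [set: H])
    (Hxi : spans_Rad xi)
    (HN : null_transversal xi N)
    (Hgeod : totally_geodesic H)
    (HS : A_tensor N S)
    (Halpha : smooth_fun [set: H] alpha)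
    (Hbeta : smooth_fun [set: H] beta)
    (Hdistinct : forall x, [/\ lam0 != alpha x, lam0 != beta x
                             & alpha x != beta x])
    (Heigen : forall x (a : R),
       eigenvalue (S x) a = [|| a == lam0, a == alpha x | a == beta x])
    (Htrace : exists c : R, forall x, \tr (S x) = c)
    (HD0 : forall x, (eigenspace (S x) lam0 == Rad x)%MS)
    (Hscreen : forall x,
       (eigenspace (S x) (alpha x) + eigenspace (S x) (beta x) == screen x)%MS
       /\ (eigenspace (S x) (alpha x) :&: eigenspace (S x) (beta x) = 0)%MS) :
  (forall x, (grad N alpha x <= Rad x)%MS /\ (grad N beta x <= Rad x)%MS) /\
  (screen_totally_geodesic N ->
     ((integrable_dist (fun x => eigenspace (S x) (alpha x)) /\
       integrable_dist (fun x => eigenspace (S x) (beta x)))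
      <->
      (forall (U : set H) (X Y : H -> 'rV[R]_n.+1), open U ->
         in_dist (@screen R n H) U X -> in_dist (@screen R n H) U Y ->
         forall x, U x -> nablaS N S X Y x = 0))).
Proof.
have split : eigensplit S lam0 alpha beta.
  by move=> x; split; [exact: Hdistinct|exact: HD0|have [] := Hscreen x].
have sp' := eigensplit_sym split.
have ea x : eigenvalue (S x) (alpha x) by rewrite Heigen eqxx orbT.
have eb x : eigenvalue (S x) (beta x) by rewrite Heigen eqxx !orbT.
have [c trS] := Htrace.
have eigen0 (al be : H -> R) x v : eigensplit S lam0 al be ->
    smooth_fun [set: H] al -> smooth_fun [set: H] be ->
    (forall x, eigenvalue (S x) (al x)) -> (forall x, eigenvalue (S x) (be x)) ->
    (v <= screen x)%MS -> dfun al x v = 0.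
  move=> sp sa sb eal ebe /(screen_eigen_decomp sp)[a aa [b bb ->]].
  have := dfun_linear (I : [set: H] x) sa 1 a b; rewrite !scale1r => ->.
  rewrite (dfun_eigen_eq0 Hxi HN HS sp sa sb aa) add0r.
  (* Along the [be]-eigenspace the A-tensor condition gives constancy of [be]; the trace, with the
     roles exchanged, passes it on to [al]. *)
  apply: (dfun_eigen_trace Hxi HN (eigensplit_sym sp) sb sa eal trS).
  exact: (dfun_eigen_eq0 Hxi HN HS (eigensplit_sym sp) sb sa bb).
have da x v := eigen0 alpha beta x v split Halpha Hbeta ea eb.
have db x v := eigen0 beta alpha x v sp' Hbeta Halpha eb ea.
split=> [x|Hstg].
  by split; apply: (grad_Rad Hxi HN) => // v; [exact: da|exact: db].
have G : adapted S lam0 alpha beta by split.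
split=> [[Ia Ib] U X Y oU dX dY x Ux|nab0].
  exact: (integrable_nabS_eq0 Hxi HN Hgeod HS Hstg G Ia Ib oU Ux dX dY).
split; first exact: (nabS_eq0_integrable Hxi HN Hgeod G nab0).
exact: (nabS_eq0_integrable Hxi HN Hgeod (adapted_sym G) nab0).
Qed.
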